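(* Let $p \in (0,1)$, $q \geq 2$ and $\Lambda \geq 1$. There exists a constant $C = C(p,q,\Lambda) > 0$, depending only on $p$, $q$ and $\Lambda$, such that the following holds. Let $f \in L^{\infty}(\mathbb{S}^{1})$ satisfy $1/\Lambda \leq f \leq \Lambda$, and let $K \in \mathcal{K}^{2}_{o}$ be a convex body that solves the planar $L_p$ dual Minkowski equation $$h_K^{1-p}\,(h_K^2+|\nabla h_K|^2)^{\frac{q-2}{2}}\,(\nabla^2 h_K + h_K) = f \quad \text{on } \mathbb{S}^{1},$$ that is, $\widetilde{C}_{p,q}(K,\cdot) = f\,\mathrm{d}\mathcal{H}^{1}$ as measures on $\mathbb{S}^1$. Then $\|h_K\|_{L^{\infty}(\mathbb{S}^{1})} \leq C$.
   Context: $\mathbb{S}^1$ is the unit circle in $\mathbb{R}^2$, $\mathcal{H}^1$ is one-dimensional Hausdorff measure (arc length), and $\nabla$ is the covariant derivative on $\mathbb{S}^1$. A convex body is a compact convex set with nonempty interior; $\mathcal{K}^2_o$ denotes the set of all convex bodies in $\mathbb{R}^2$ containing the origin (not necessarily in the interior). The support function of $K$ is $h_K(u)=\max\{u\cdot x : x\in K\}$, $u\in\mathbb{S}^1$. The $L_p$ dual curvature measure $\widetilde{C}_{p,q}(K,\cdot)$ of $K \in \mathcal{K}^2_o$ is the Borel measure on $\mathbb{S}^1$ which in terms of the surface area measure $S(K,\cdot)$ is $\rho^{q-2}h_K^{1-p}\,\mathrm{d}S(K,\cdot)$, where $\rho$ is the distance from the origin to the boundary point with outer unit normal $u$; explicitly,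 for Borel $\omega\subset\mathbb{S}^1$, $$\widetilde{C}_{p,q}(K,\omega)=\int_{\{x\in\partial K:\ N(x)\in\omega\}} |x|^{q-2}\,(x\cdot N(x))^{1-p}\,\mathrm{d}\mathcal{H}^1(x),$$ where $N(x)$ is the outer unit normal of $\partial K$ at $x$, defined for $\mathcal{H}^1$-a.e. $x\in\partial K$, and the factor $|x|^{q-2}$ is read as $1$ when $q=2$. When $h_K$ is smooth and positive, the equation $\widetilde{C}_{p,q}(K,\cdot)=f\,\mathrm{d}\mathcal{H}^1$ is the displayed differential equation. *)

(* Defs.v *)
From HB Require Import structures.
From mathcomp Require Import all_boot all_order all_algebra.
From mathcomp Require Import all_classical all_reals all_analysis.
From mathcomp Require Import measurable_realfun ess_sup_inf ring lra.

Set Implicit Arguments.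
Unset Strict Implicit.
Unset Printing Implicit Defensive.
Import Order.TTheory GRing.Theory Num.Theory.
Import numFieldNormedType.Exports.

Local Open Scope classical_set_scope.
Local Open Scope ring_scope.

(* The plane is R * R.  The library's norm on a product is the max norm, which
   induces the right topology and Borel sets but not the right lengths, hence
   the explicit Euclidean norm. *)
Section euclidean_plane.
Context {R : realType}.
Implicit Types u v x : (R * R)%type.

Definition dot u v : R := u.1 * v.1 + u.2 * v.2.

Definition eucl_norm v : R := Num.sqrt (dot v v).

Definition unit_circle : set (R * R) := [set u | eucl_norm u = 1].

Lemma normr_fst_le v : `|v.1| <= eucl_norm v.
Proof.
by rewrite -sqrtr_sqr ler_sqrt ?addr_ge0 ?sqr_ge0// /dot; nra.
Qed.

Lemma normr_snd_le v : `|v.2| <= eucl_norm v.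
Proof.
by rewrite -sqrtr_sqr ler_sqrt ?addr_ge0 ?sqr_ge0// /dot; nra.
Qed.

End euclidean_plane.

Section hausdorff_measure.
Context {R : realType}.
Local Notation P := (R * R)%type.
Local Open Scope ereal_scope.
Implicit Types (A B X : set P) (U : (set P)^nat) (delta : R).

(* The point 0 is thrown in so that the diameter of the empty set is 0. *)
Definition diam A : \bar R :=
  ereal_sup (0 |` [set (eucl_norm (z.1 - z.2)%R)%:E | z in A `*` A]).

Definition hausdorff_cover delta A : set ((set P)^nat) :=
  [set U | (forall k, diam (U k) <= delta%:E) /\ A `<=` \bigcup_k U k].

Definition hausdorff_content delta A : \bar R :=
  ereal_inf [set \sum_(k <oo) diam (U k) | U in hausdorff_cover delta A].

Definition hausdorff1 A : \bar R :=
  ereal_sup [set hausdorff_content delta A | delta in [set d : R | (0 < d)%R]].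

Lemma diam_ge0 A : 0 <= diam A.
Proof. by apply: ereal_sup_ubound; left. Qed.

Lemma diam0 : diam set0 = 0.
Proof.
apply/eqP; rewrite eq_le diam_ge0 andbT; apply: ge_ereal_sup.
by move=> _ [->//|[z [//]]].
Qed.

Lemma le_diam A x y : A x -> A y -> (eucl_norm (x - y)%R)%:E <= diam A.
Proof. by move=> Ax Ay; apply: ereal_sup_ubound; right; exists (x, y). Qed.

Lemma hausdorff_content_ge0 delta A : 0 <= hausdorff_content delta A.
Proof.
apply: le_ereal_inf_tmp => _ [U _ <-]; apply: nneseries_ge0 => k _ _.
exact: diam_ge0.
Qed.

Lemma hausdorff_content_le delta A :
  (0 < delta)%R -> hausdorff_content delta A <= hausdorff1 A.
Proof. by move=> d0; apply: ereal_sup_ubound; exists delta. Qed.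

Lemma hausdorff_content_sigma_subadditive delta :
  (0 < delta)%R -> forall A (F : (set P)^nat), A `<=` \bigcup_n F n ->
  hausdorff_content delta A <= \sum_(n <oo) hausdorff_content delta (F n).
Proof.
move=> d0 A F AF; set H := hausdorff_content delta.
have [[i ioo]|] := pselect (exists i, H (F i) = +oo).
  rewrite (eseries_pinfty _ _ ioo) ?leey// => n _.
  by rewrite -ltNye (lt_le_trans _ (hausdorff_content_ge0 _ _)).
rewrite -forallNE => Foo.
suff add2e (e : {posnum R}) : H A <= \sum_(i <oo) H (F i) + e%:num%:E.
  by apply/lee_addgt0Pr => _/posnumP[].
rewrite (le_trans _ (epsilon_trick _ _ _))//; last first.
  by move=> n; exact: hausdorff_content_ge0.
pose Q n (B : (set P)^nat) := hausdorff_cover delta (F n) B /\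
  \sum_(k <oo) diam (B k) <= H (F n) + (e%:num / (2 ^ n.+1)%:R)%:E.
have [G QG] : {G : ((set P)^nat)^nat & forall n, Q n (G n)}.
  apply: (@choice _ _ Q) => n; rewrite /Q /H /hausdorff_content.
  set S := (X in ereal_inf X); move infS : (ereal_inf S) => iS.
  case: iS infS => [r Sr|Soo|Soo].
  - have en1 : (0 < e%:num / (2 ^ n.+1)%:R)%R by [].
    have /(lb_ereal_inf_adherent en1) : ereal_inf S \is a fin_num by rewrite Sr.
    move=> [x [B cB muBx] xS].
    by exists B; split => //; rewrite muBx -Sr; exact/ltW.
  - by have := Foo n; rewrite /H /hausdorff_content Soo.
  - have := hausdorff_content_ge0 delta (F n).
    by rewrite /hausdorff_content Soo.
have G_ge0 x : 0 <= (diam \o uncurry G) x by exact: diam_ge0.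
apply: (@le_trans _ _ (\esum_(i in setT) (diam \o uncurry G) i)).
  apply: ereal_inf_lbound => /=.
  have /card_esym/ppcard_eqP[f] := card_nat2.
  exists (uncurry G \o f).
    split => [i /=|].
      by rewrite /uncurry; move: (f i) => [a b]; exact: (QG a).1.1.
    move=> t /AF[i _ /((QG i).1.2)[j _ Gijt]].
    by exists (f^-1%FUN (i, j)) => //=; rewrite invK ?inE.
  rewrite -(esum_pred_image (diam \o uncurry G) _ xpredT) ?[fun=> _]set_true//.
  by rewrite image_eq.
rewrite (_ : esum _ _ = \sum_(i <oo) \sum_(j <oo ) diam (G i j)); last first.
  pose J : nat -> set (nat * nat) := fun i => [set (i, j) | j in setT].
  rewrite (_ : setT = \bigcup_k J k); last first.
    by rewrite predeqE => -[a b]; split => // _; exists a => //; exists b.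
  rewrite esum_bigcupT /=; last 2 first.
    - apply/trivIsetP => i j _ _ ij.
      rewrite predeqE => -[n m] /=; split => //= -[] [_] _ [<-{n} _].
      by move=> [m' _] [] /esym/eqP; rewrite (negbTE ij).
    - by move=> /= [n m]; exact: diam_ge0.
  rewrite -(image_id [set: nat]) -fun_true esum_pred_image//; last first.
    by move=> n _; apply: esum_ge0 => x _; exact: diam_ge0.
  apply: eq_eseriesr => /= j _.
  rewrite -(esum_pred_image (diam \o uncurry G) (pair j) predT)//=; last 2 first.
    - by move=> n _; exact: diam_ge0.
    - by move=> ? ? _ _; exact: (@can_inj _ _ _ snd).
  by congr esum; rewrite predeqE => -[a b]; split; move=> [i _ <-]; exists i.
apply: lee_lim.
- apply: is_cvg_nneseries => n *.
  by apply: nneseries_ge0 => m *; exact: (G_ge0 (n, m)).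
- apply: is_cvg_nneseries => n *; apply: adde_ge0 => //.
  exact: hausdorff_content_ge0.
- by near=> n; apply: lee_sum => i _; exact: (QG i).2.
Unshelve. all: by end_near. Qed.

Let hausdorff1_ge0 A : 0 <= hausdorff1 A.
Proof.
apply: le_trans (hausdorff_content_ge0 1 A) _.
exact: hausdorff_content_le.
Qed.

Let hausdorff1_set0 : hausdorff1 set0 = 0.
Proof.
apply/eqP; rewrite eq_le hausdorff1_ge0 andbT; apply: ge_ereal_sup.
move=> _ [d /= d0 <-]; apply: ereal_inf_lbound; exists (fun=> set0).
  by split => [k|//]; rewrite diam0 lee_fin ltW.
by rewrite eseries0// => k _ _; rewrite diam0.
Qed.

Let hausdorff1_sigma_subadditive A F : subset_sigma_subadditive hausdorff1 A F.
Proof.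
move=> AF; apply: ge_ereal_sup => _ [d /= d0 <-].
apply: le_trans (hausdorff_content_sigma_subadditive d0 AF) _.
apply: lee_nneseries => [k *|k *]; first exact: hausdorff_content_ge0.
exact: hausdorff_content_le.
Qed.

HB.instance Definition _ := isSubsetOuterMeasure.Build R P hausdorff1
  hausdorff1_set0 hausdorff1_ge0 hausdorff1_sigma_subadditive.

Let hausdorff_content_antitone delta eps A :
  (delta <= eps)%R -> hausdorff_content eps A <= hausdorff_content delta A.
Proof.
move=> de; apply: ereal_inf_le_tmp => _ [U [dU AU] <-]; exists U => //.
by split => // k; rewrite (le_trans (dU k))// lee_fin.
Qed.

Lemma hausdorff_content_separated delta (e : R) A B : (delta < e)%R ->
  (forall x y, A x -> B y -> (e <= eucl_norm (x - y))%R) ->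
  hausdorff_content delta A + hausdorff_content delta B <=
  hausdorff_content delta (A `|` B).
Proof.
move=> de AB; apply: le_ereal_inf_tmp => _ [U [dU ABU] <-].
pose V C k := if `[< U k `&` C !=set0 >] then U k else set0.
have coverV C : C `<=` A `|` B -> hausdorff_content delta C <=
    \sum_(k <oo) diam (V C k).
  move=> CAB; apply: ereal_inf_lbound; exists (V C) => //; split => [k|x Cx].
    rewrite /V; case: asboolP => // _; rewrite diam0.
    exact: le_trans (diam_ge0 _) (dU k).
  have /ABU[k _ Ukx] := CAB _ Cx; exists k => //.
  by rewrite /V; case: asboolP => //; case; exists x.
apply: (le_trans (leeD (coverV _ (@subsetUl _ _ _))
                       (coverV _ (@subsetUr _ _ _)))).
rewrite -nneseriesD; [|by move=> *; exact: diam_ge0..].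
apply: lee_nneseries => [k *|k *]; first by rewrite adde_ge0 ?diam_ge0.
rewrite /V; case: asboolP => [[x [Ux Ax]]|_]; last first.
  by rewrite diam0 add0e; case: asboolP => // _; rewrite diam0 diam_ge0.
case: asboolP => [[y [Uy By]]|_]; last by rewrite diam0 adde0.
have := le_trans (le_diam Ux Uy) (dU k).
by rewrite lee_fin => /(le_trans (AB _ _ Ax By)); rewrite leNgt de.
Qed.

Lemma hausdorff1_separated (e : R) A B : (0 < e)%R ->
  (forall x y, A x -> B y -> (e <= eucl_norm (x - y))%R) ->
  hausdorff1 A + hausdorff1 B <= hausdorff1 (A `|` B).
Proof.
move=> e0 AB.
have key d1 d2 : (0 < d1)%R -> (0 < d2)%R ->
    hausdorff_content d1 A + hausdorff_content d2 B <= hausdorff1 (A `|` B).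
  move=> d10 d20; pose d := Num.min (Num.min d1 d2) (e / 2)%R.
  have d0 : (0 < d)%R by rewrite !lt_min d10 d20 divr_gt0.
  have de : (d < e)%R.
    by rewrite /d gt_min; apply/orP; right; rewrite ltr_pdivrMr// ltr_pMr ?ltr1n.
  have dd1 : (d <= d1)%R by rewrite /d !ge_min lexx.
  have dd2 : (d <= d2)%R by rewrite /d !ge_min lexx orbT.
  apply: le_trans (hausdorff_content_le _ d0).
  apply: le_trans (hausdorff_content_separated de AB).
  by apply: leeD; exact: hausdorff_content_antitone.
have [->|Boo] := eqVneq (hausdorff1 (A `|` B)) +oo; first by rewrite leey.
have fin C : C `<=` A `|` B -> hausdorff1 C \is a fin_num.
  move=> CAB; rewrite ge0_fin_numE//.
  apply: (@le_lt_trans _ _ (hausdorff1 (A `|` B))).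
    exact: (le_outer_measure hausdorff1).
  by rewrite ltey.
have finA := fin _ (@subsetUl _ A B); have finB := fin _ (@subsetUr _ A B).
rewrite -leeBrDr//; apply: ge_ereal_sup => _ [d1 /= d10 <-].
rewrite leeBrDr// addeC -leeBrDr; last first.
  rewrite ge0_fin_numE ?hausdorff_content_ge0//.
  by rewrite (le_lt_trans (hausdorff_content_le A d10))// -ge0_fin_numE.
apply: ge_ereal_sup => _ [d2 /= d20 <-].
rewrite leeBrDr; last first.
  rewrite ge0_fin_numE ?hausdorff_content_ge0//.
  by rewrite (le_lt_trans (hausdorff_content_le A d10))// -ge0_fin_numE.
by rewrite addeC key.
Qed.

(* Caratheodory's criterion, for the superlevel sets of a 1-Lipschitz map. *)
Lemma hausdorff1_caratheodory (g : P -> R) (a : R) :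
  (forall x y, (`|g x - g y| <= eucl_norm (x - y))%R) ->
  hausdorff1.-caratheodory [set x | (a < g x)%R].
Proof.
move=> gL; apply: (@le_caratheodory_measurable _ _ hausdorff1) => X /=.
have [->|Xoo] := eqVneq (hausdorff1 X) +oo; first by rewrite leey.
pose t n : R := (a + n.+1%:R^-1)%R.
have tS n : (t n.+1 < t n)%R by rewrite ltrD2l ltf_pV2 ?posrE ?ltr_nat.
have t_le m n : (m <= n)%N -> (t n <= t m)%R.
  by move=> mn; rewrite lerD2l lef_pV2 ?posrE ?ler_nat.
pose S n := X `&` [set x | (t n < g x)%R].
pose L n := S n.+1 `\` S n.
set Y := X `&` _; set Z := X `&` _.
have SX n : hausdorff1 (S n) <= hausdorff1 X.
  by apply: (le_outer_measure hausdorff1); exact: subIsetl.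
have sep n A : A `<=` X -> (forall x, A x -> (g x <= t n.+1)%R) ->
    hausdorff1 (S n) + hausdorff1 A <= hausdorff1 (S n `|` A).
  move=> AX At; apply: (@hausdorff1_separated (t n - t n.+1)%R).
    by rewrite subr_gt0.
  move=> x y [_ /= Sx] /At Ay; apply: le_trans (gL x y).
  by apply: le_trans (ler_norm _); rewrite lerB// ltW.
have SZ n : hausdorff1 (S n) + hausdorff1 Z <= hausdorff1 X.
  apply: le_trans (sep _ _ _ _) _; first exact: subIsetl.
    move=> x [_ /= /negP]; rewrite -leNgt => /le_trans; apply.
    by rewrite lerDl.
  apply: (le_outer_measure hausdorff1).
  by rewrite subUset; split; exact: subIsetl.
have SL n : hausdorff1 (S n) + hausdorff1 (L n.+1) <= hausdorff1 (S n.+2).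
  apply: le_trans (sep _ _ _ _) _.
  - by move=> x [[]].
  - move=> x [[Xx _] /= nS]; rewrite leNgt; apply/negP => tx.
    by apply: nS; split.
  - apply: (le_outer_measure hausdorff1) => x [[Xx /= tx]|[]//].
    split => //=; apply: le_lt_trans tx; apply: t_le.
    by rewrite -addn2 leq_addr.
have sumL n : \sum_(0 <= k < n.+1) hausdorff1 (L k) <=
    hausdorff1 (S n.+1) + hausdorff1 (S n).
  elim: n => [|n ih].
    rewrite big_nat1; apply: (@le_trans _ _ (hausdorff1 (S 1%N))).
      by apply: (le_outer_measure hausdorff1) => x [].
    by rewrite leeDl.
  rewrite big_nat_recr//=; apply: le_trans (leeD2r _ ih) _.
  by rewrite -addeA addeC leeD2r.
have sumLoo : \sum_(0 <= k <oo) hausdorff1 (L k) < +oo.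
  apply: (@le_lt_trans _ _ (hausdorff1 X + hausdorff1 X)); last first.
    by rewrite lte_add_pinfty// ltey.
  apply: lime_le; first exact: is_cvg_nneseries.
  near=> n; have n0 : (0 < n)%N by near: n; exists 1%N.
  by rewrite -(prednK n0); apply: le_trans (sumL _) _; exact: leeD.
have tail n : hausdorff1 Y + hausdorff1 Z <=
    hausdorff1 X + \sum_(n <= k <oo) hausdorff1 (L k).
  have YSL : hausdorff1 Y <=
      hausdorff1 (S n) + \sum_(n <= k <oo) hausdorff1 (L k).
    apply: (@le_trans _ _
      (hausdorff1 (S n `|` \bigcup_(k in ~` `I_n) L k))); last first.
      apply: le_trans (outer_measureU2 hausdorff1 _ _) _.
      rewrite leeD2l//.
      exact: (outer_measure_sigma_subadditive_tail hausdorff1).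
    apply: (le_outer_measure hausdorff1) => x [Xx /= ax].
    have exS : exists m, `[< S m x >].
      exists (Num.trunc ((g x - a)^-1)); apply/asboolP; split => //=.
      rewrite /t -ltrBrDl invf_plt ?posrE ?subr_gt0//.
      exact: truncnS_gt.
    case: (ex_minnP exS) => m /asboolP Smx mmin.
    have [mn|nm] := leqP m n.
      left; split => //=; apply: le_lt_trans (Smx.2); exact: t_le.
    have m0 : (0 < m)%N by exact: leq_ltn_trans nm.
    right; exists m.-1.
      by apply/negP; rewrite -leqNgt -ltnS prednK.
    split; first by rewrite prednK.
    by move=> /asboolP /mmin; rewrite leqNgt prednK// leqnn.
  apply: le_trans (leeD2r _ YSL) _.
  by rewrite addeAC leeD2r.
have h : hausdorff1 X + \sum_(n <= k <oo) hausdorff1 (L k)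
    @[n --> \oo] --> hausdorff1 X.
  rewrite -[X in _ --> X]adde0; apply: cvgeD; first exact: fin_num_adde_defl.
    exact: cvg_cst.
  exact: nneseries_tail_cvg.
rewrite -(cvg_lim _ h)//; apply: lime_ge; first by apply/cvg_ex; exists (hausdorff1 X).
by near=> n; exact: tail.
Unshelve. all: by end_near. Qed.

Let caratheodory_sigma_algebra :
  sigma_algebra setT (hausdorff1.-caratheodory : set (set P)).
Proof.
split.
- exact: caratheodory_measurable_set0.
- by move=> A cA; rewrite setTD; exact: caratheodory_measurable_setC.
- by move=> F cF; exact: caratheodory_measurable_bigcup.
Qed.

Let caratheodory_preimage (g : P -> R) :
  (forall x y, (`|g x - g y| <= eucl_norm (x - y))%R) ->
  forall B : set R, measurable B -> hausdorff1.-caratheodory (g @^-1` B).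
Proof.
move=> gL; pose M := [set B : set R | hausdorff1.-caratheodory (g @^-1` B)].
have sM : sigma_algebra setT M.
  split; rewrite /M /=.
  - by rewrite preimage_set0; exact: caratheodory_measurable_set0.
  - move=> A cA; rewrite setTD -preimage_setC.
    exact: caratheodory_measurable_setC.
  - move=> F cF; rewrite preimage_bigcup.
    exact: caratheodory_measurable_bigcup.
move=> B; have -> : measurable B = (@RGenOInfty.G R).-sigma.-measurable B.
  by rewrite -RGenOInfty.measurableE.
move: B; apply: smallest_sub => // _ [x ->]; rewrite /M /=.
rewrite (_ : _ @^-1` _ = [set z | (x < g z)%R]).
  exact: hausdorff1_caratheodory.
by apply/seteqP; split => z /=; rewrite in_itv/= andbT.
Qed.

Lemma measurable_hausdorff1_caratheodory A :
  measurable A -> hausdorff1.-caratheodory A.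
Proof.
move: A; apply: smallest_sub => // _ [|] [B mB <-]; rewrite setTI.
  by apply: caratheodory_preimage => // x y; exact: normr_fst_le (x - y)%R.
by apply: caratheodory_preimage => // x y; exact: normr_snd_le (x - y)%R.
Qed.

Let hausdorff1_sigma_additive :
  semi_sigma_additive (hausdorff1 : set P -> \bar R).
Proof.
move=> F mF tF mUF.
have cF k := measurable_hausdorff1_caratheodory (mF k).
apply: (@caratheodory_measure_sigma_additive _ _ hausdorff1) => //.
exact: measurable_hausdorff1_caratheodory.
Qed.

HB.instance Definition _ := isMeasure.Build _ P R hausdorff1
  hausdorff1_set0 hausdorff1_ge0 hausdorff1_sigma_additive.

End hausdorff_measure.

Section circle.
Context {R : realType}.

Lemma measurable_unit_circle : measurable (@unit_circle R).
Proof.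
have -> : @unit_circle R = setT `&` (fun v => dot v v) @^-1` [set 1].
  rewrite /unit_circle /eucl_norm setTI; apply/seteqP.
  split => v /= v1; last by rewrite v1 sqrtr1.
  by rewrite -[LHS]sqr_sqrtr ?v1 ?expr1n// addr_ge0// -expr2 sqr_ge0.
by apply: (measurable_funD (measurable_funM measurable_fst measurable_fst)
                       (measurable_funM measurable_snd measurable_snd)).
Qed.

(* H^1 on the unit circle, as a Borel measure of the plane: functions on the
   circle are taken as functions on the plane, whose values off the circle are
   irrelevant. *)
Definition arclength : {measure set (R * R) -> \bar R} :=
  mrestr hausdorff1 measurable_unit_circle.

End circle.

Section convex_geometry.
Context {R : realType}.
Implicit Types (K : set (R * R)) (u x y : (R * R)%type) (omega : set (R * R)).

Definition convex_body K := [/\ compact K, convex_set K & K° !=set0].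

Definition convex_body_o K := convex_body K /\ K 0.

Definition support_function K u : R := sup [set dot u x | x in K].

Definition boundary K : set (R * R) := closure K `\` K°.

Definition outer_unit_normal K x : set (R * R) :=
  [set u | unit_circle u /\ forall y, K y -> dot u (y - x) <= 0].

(* The boundary points at which the outer unit normal is defined, i.e. unique;
   for a convex body these are H^1-almost all boundary points. *)
Definition regular_boundary K : set (R * R) :=
  [set x | boundary K x /\ exists! u, outer_unit_normal K x u].

(* N(x), meaningful for x in regular_boundary K. *)
Definition gauss_map K x : R * R := xget 0 (outer_unit_normal K x).

(* x `^ 0 = 1 for every x, including 0, which is the convention needed for
   q = 2; for x in the boundary of K the base of the second power is
   nonnegative as soon as K contains the origin. *)
Definition lp_dual_curvature (p q : R) K omega : \bar R :=
  (\int[hausdorff1]_(x in regular_boundary K `&` gauss_map K @^-1` omega)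
     (eucl_norm x `^ (q - 2) * dot x (gauss_map K x) `^ (1 - p))%:E)%E.

End convex_geometry.

(* Main.v *)
Require Import Defs.
From mathcomp Require Import all_boot all_order all_algebra.
From mathcomp Require Import all_classical all_reals all_analysis.
From mathcomp Require Import measurable_realfun ess_sup_inf ring lra.

Set Implicit Arguments.
Unset Strict Implicit.
Unset Printing Implicit Defensive.
Import Order.TTheory GRing.Theory Num.Theory.
Import numFieldNormedType.Exports.

Local Open Scope classical_set_scope.
Local Open Scope ring_scope.

(** Let D be the largest distance of a point of K from the origin, attained at
    D e with e a unit vector. The claim is D <= 192 Lambda / p; since the support
    function is at most D on the circle, this gives the theorem.

    Complete e to an orthonormal pair (e, e') and follow the outer normals
    dir t = (1 - t) e + t e' for t between 0 and 3/2. The support function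
    h(t) = max (x . dir t) is convex in t, with subgradients x . (e' - e) at the
    support points x, and it starts from h(0) = D with slope - D. While the slope
    stays steep, the support points satisfy |x| >= 1, and since q >= 2 the
    upper bound f <= Lambda gives h'' h^(1 - p) <= c Lambda ([slope_increment]).
    Multiplication by h' shows that h' + kappa h^p is nonincreasing, where kappa
    is of order Lambda / (p D). As p < 1, the second term is too small to stop
    the descent when D is large, and h reaches 0 before t = 3/2
    ([subgradient_zero]).

    The same holds for the pair (e, - e'). So K lies in two half-planes bounded
    by lines through the origin and not opposite to each other, as K has
    interior points. The support function of K then vanishes on a whole arc of
    normals, where the curvature measure is 0 because of the factor
    (x . N)^(1 - p). This contradicts f >= 1 / Lambda ([support_zero_null]).

    No regularity of K is available, so the differential inequality is obtained
    in integrated form. The arc of normals between dir a and dir b is a Lipschitz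
    image of the interval from a to b, whence an upper bound for its length
    ([hausdorff1_lipschitz_image]). The part of the boundary with these normals
    projects onto the interval of slopes, whence a lower bound for its length
    ([hausdorff1_ge_projection]). Boundary points with several normals are
    countably many, each being the support point in a rational direction
    ([top_arc_regular]). The computation with h' + kappa h^p is carried out in
    finitely many small steps ([energy_step]). *)

(** * Hausdorff measure of Lipschitz images and projections *)

Section hausdorff_bounds.
Context {R : realType}.
Local Notation P := (R * R)%type.

Lemma equal_steps_cover (a h : R) n (t : R) :
  a <= t <= a + n.+1%:R * h ->
  exists2 k, (k <= n)%N & a + k%:R * h <= t <= a + k.+1%:R * h.
Proof.
elim: n => [|n ih] /andP[at_ tb]; first by exists 0%N; rewrite // mul0r addr0 at_.
have [tn|nt] := leP t (a + n.+1%:R * h).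
  by have [|k kn tk] := ih; [rewrite at_|exists k => //; rewrite (leq_trans kn)].
by exists n.+1 => //; rewrite (ltW nt).
Qed.

Lemma diam_le (A : set P) (d : R) : 0 <= d ->
  (forall x y, A x -> A y -> eucl_norm (x - y) <= d) -> (diam A <= d%:E)%E.
Proof.
move=> d0 Ad; apply: ge_ereal_sup => _ [->|[[x y] [/= Ax Ay] <-]].
  by rewrite lee_fin.
by rewrite lee_fin Ad.
Qed.

(** Cutting `[a, b] into n equal pieces gives covers of the image of arbitrarily
    small mesh, all of total diameter at most L (b - a). *)
Lemma hausdorff1_lipschitz_image (g : R -> P) (a b L : R) :
  a <= b -> 0 <= L ->
  (forall s t, a <= s <= b -> a <= t <= b ->
    eucl_norm (g s - g t) <= L * `|s - t|) ->
  (hausdorff1 (g @` `[a, b]) <= (L * (b - a))%:E)%E.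
Proof.
move=> ab L0 gL; apply: ge_ereal_sup => _ [d /= d0 <-].
have [n nd] : exists n, L * (b - a) < n.+1%:R * d.
  exists (Num.truncn (L * (b - a) / d)).
  by rewrite -ltr_pdivrMr// truncnS_gt.
pose h := (b - a) / n.+1%:R.
have nh : n.+1%:R * h = b - a by rewrite /h mulrC divfK// pnatr_eq0.
have h0 : 0 <= h by rewrite divr_ge0// subr_ge0.
pose U k := if (k < n.+1)%N then
  g @` [set t | a + k%:R * h <= t <= a + k.+1%:R * h] else set0.
have Ud k : (diam (U k) <= (L * h)%:E)%E.
  rewrite /U; case: ifPn => [kn|_]; last first.
    by rewrite diam0 lee_fin mulr_ge0.
  have kh : a + k.+1%:R * h <= b.
    by rewrite -lerBrDl -nh ler_wpM2r// ler_nat.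
  have k1 : k.+1%:R * h = k%:R * h + h by rewrite -natr1 mulrDl mul1r.
  have kh0 : 0 <= k%:R * h by rewrite mulr_ge0.
  apply: diam_le; first by rewrite mulr_ge0.
  move=> _ _ [s /= /andP[s1 s2] <-] [t /= /andP[t1 t2] <-].
  apply: le_trans (gL _ _ _ _) _; [by apply/andP; split; lra..|].
  rewrite ler_wpM2l// ler_norml; apply/andP; split; lra.
apply: (@le_trans _ _ (\sum_(k <oo) diam (U k))%E).
  apply: ereal_inf_lbound; exists U => //; split => [k|_ [t /= tab <-]].
    apply: le_trans (Ud k) _; rewrite lee_fin /h mulrA ler_pdivrMr//.
    by rewrite [leRHS]mulrC ltW.
  have [|k kn tk] := @equal_steps_cover a h n t.
    by rewrite nh subrKC; rewrite in_itv in tab.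
  by exists k => //; rewrite /U ltnS kn; exists t.
rewrite (nneseries_split 0%N n.+1); last by move=> k _; exact: diam_ge0.
rewrite add0n (eseries0 (f := fun k => diam (U k))); last first.
  by move=> k nk _; rewrite /U ltnNge nk diam0.
rewrite adde0 -nh mulrCA.
apply: (@le_trans _ _ (\sum_(0 <= k < n.+1) (L * h)%:E)%E).
  by apply: lee_sum.
by rewrite sumEFin lee_fin big_const_nat iter_addr_0 subn0 mulr_natl.
Qed.

(** A 1-Lipschitz map sends a set of diameter d into an interval of length at
    most d, so a cover of X gives a cover of `]a, b[ up to C by intervals whose
    total length is at most the total diameter. The countable set C is there
    to absorb the boundary points without a unique normal. *)
Lemma hausdorff1_ge_projection (g : P -> R) (X : set P) (C : set R) (a b : R) :
  (forall x y, `|g x - g y| <= eucl_norm (x - y)) -> countable C ->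
  `]a, b[ `<=` g @` X `|` C -> ((b - a)%:E <= hausdorff1 X)%E.
Proof.
move=> gL cC abX; apply: le_trans (hausdorff_content_le _ ltr01).
apply: le_ereal_inf_tmp => _ [U [dU XU] <-].
have [ba|ab] := leP b a.
  apply: (@le_trans _ _ 0%E); first by rewrite lee_fin subr_le0.
  by apply: nneseries_ge0 => k _ _; exact: diam_ge0.
pose J k := if `[< U k !=set0 >]
  then `[inf (g @` U k), sup (g @` U k)]%classic else set0.
have UdE k : exists2 d : R, diam (U k) = d%:E &
    forall x y, U k x -> U k y -> g x <= g y + d.
  have fd : diam (U k) \is a fin_num.
    by rewrite ge0_fin_numE ?diam_ge0// (le_lt_trans (dU k))// ltry.
  exists (fine (diam (U k))); first by rewrite fineK.
  move=> x y Ux Uy; rewrite addrC -lerBlDr -lee_fin fineK//.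
  apply: le_trans (le_diam Ux Uy); rewrite lee_fin.
  exact: le_trans (ler_norm _) (gL x y).
have mJ k : measurable (J k) by rewrite /J; case: ifP.
have hs k : U k !=set0 -> has_sup (g @` U k) /\ has_inf (g @` U k).
  move=> [y Uy]; have [d _ gd] := UdE k; split; split.
  - by exists (g y), y.
  - by exists (g y + d) => _ [x Ux <-]; exact: gd.
  - by exists (g y), y.
  - by exists (g y - d) => _ [x Ux <-]; rewrite lerBlDr gd.
have lJ k : (lebesgue_measure (J k) <= diam (U k))%E.
  rewrite /J; case: asboolP => [Uk|_]; last by rewrite measure0 diam_ge0.
  have [d -> gd] := UdE k; have [hS hI] := hs _ Uk.
  rewrite lebesgue_measure_itv/= lte_fin; case: ifP => [_|_]; last first.
    by case: Uk => y Uy; rewrite lee_fin -(lerD2l (g y)) addr0 gd.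
  rewrite -EFinD lee_fin lerBlDr addrC -lerBlDr.
  apply: lb_le_inf; first by case: hI.
  move=> _ [y Uy <-]; rewrite lerBlDr; apply: ge_sup; first by case: hS.
  by move=> _ [x Ux <-]; exact: gd.
have mC : measurable C by exact: countable_measurable.
have mUJ : measurable (\bigcup_k J k) by exact: bigcupT_measurable.
have abJ : `]a, b[ `<=` \bigcup_k J k `|` C.
  move=> t /abX[[x Xx <-]|]; last by right.
  left; have [k _ Ukx] := XU _ Xx; exists k => //.
  have Uk : U k !=set0 by exists x.
  have [hS hI] := hs _ Uk.
  rewrite /J asboolT//= in_itv/= ge_inf ?sup_upper_bound//=; try by exists x.
  by case: hI.
apply: (@le_trans _ _ (lebesgue_measure `]a, b[)).
  by rewrite lebesgue_measure_itv/= lte_fin ab.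
apply: (@le_trans _ _ (lebesgue_measure (\bigcup_k J k `|` C))).
  by apply: le_measure; rewrite ?inE//; exact: measurableU.
apply: (@le_trans _ _ (lebesgue_measure (\bigcup_k J k) + lebesgue_measure C)%E).
  exact: measureU2.
rewrite [X in (_ + X)%E]countable_lebesgue_measure0// adde0.
apply: (@le_trans _ _ (\sum_(k <oo) lebesgue_measure (J k))%E).
  exact: measure_sigma_subadditive.
by apply: lee_nneseries => k *; [exact: measure_ge0|exact: lJ].
Qed.

End hausdorff_bounds.

(** * Euclidean geometry of the plane *)

Section plane.
Context {R : realType}.
Local Notation P := (R * R)%type.
Implicit Types (u v x y z e : P).

Lemma dotDr u x y : dot u (x + y) = dot u x + dot u y.
Proof. by rewrite /dot /=; ring. Qed.

Lemma dotDl u v x : dot (u + v) x = dot u x + dot v x.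
Proof. by rewrite /dot /=; ring. Qed.

Lemma dotBl u v x : dot (u - v) x = dot u x - dot v x.
Proof. by rewrite /dot /=; ring. Qed.

Lemma dotNl u x : dot (- u) x = - dot u x.
Proof. by rewrite /dot /=; ring. Qed.

Lemma dotBr u x y : dot u (x - y) = dot u x - dot u y.
Proof. by rewrite /dot /=; ring. Qed.

Lemma dotZr a u x : dot u (a *: x) = a * dot u x.
Proof. by rewrite /dot /= !/(_ *: _)/=; ring. Qed.

Lemma dotZl a u x : dot (a *: u) x = a * dot u x.
Proof. by rewrite /dot /= !/(_ *: _)/=; ring. Qed.

Lemma dotC u v : dot u v = dot v u.
Proof. by rewrite /dot mulrC [X in _ + X]mulrC. Qed.

Lemma dot0r u : dot u 0 = 0.
Proof. by rewrite /dot /= !mulr0 addr0. Qed.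

Lemma dot_ge0 v : 0 <= dot v v.
Proof. by rewrite addr_ge0// -expr2 sqr_ge0. Qed.

Lemma eucl_norm_ge0 v : 0 <= eucl_norm v.
Proof. exact: sqrtr_ge0. Qed.

Lemma sqr_eucl_norm v : eucl_norm v ^+ 2 = dot v v.
Proof. by rewrite sqr_sqrtr// dot_ge0. Qed.

Lemma eucl_norm_le v (c : R) : 0 <= c -> (eucl_norm v <= c) = (dot v v <= c ^+ 2).
Proof. by move=> c0; rewrite -sqr_eucl_norm ler_sqr// nnegrE eucl_norm_ge0. Qed.

Lemma eucl_norm_ge v (c : R) : 0 <= c -> (c <= eucl_norm v) = (c ^+ 2 <= dot v v).
Proof. by move=> c0; rewrite -sqr_eucl_norm ler_sqr// nnegrE eucl_norm_ge0. Qed.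

Lemma unit_circleE u : unit_circle u <-> dot u u = 1.
Proof.
rewrite -sqr_eucl_norm /unit_circle /=; split=> [->|/eqP]; first by rewrite expr1n.
by rewrite sqrf_eq1 => /orP[/eqP //|/eqP h]; have := eucl_norm_ge0 u; rewrite h; lra.
Qed.

Lemma unit_circle_normalize v : 0 < eucl_norm v ->
  unit_circle ((eucl_norm v)^-1 *: v).
Proof.
move=> v0; apply/unit_circleE; rewrite dotZl dotZr -sqr_eucl_norm.
by rewrite expr2 mulKf ?gt_eqF// mulVf ?gt_eqF.
Qed.

(** Identifies the factor c when a unit vector is known to be c v. *)
Lemma eucl_norm_scaled_unit (c : R) v : 0 < c -> dot (c *: v) (c *: v) = 1 ->
  (eucl_norm v)^-1 = c.
Proof.
move=> c0; rewrite dotZl dotZr => cv1.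
have c2 : c ^+ 2 != 0 by rewrite expf_eq0/= gt_eqF.
rewrite -[RHS]invrK; congr (_^-1).
rewrite -[RHS]ger0_norm ?invr_ge0 ?(ltW c0)// -sqrtr_sqr /eucl_norm.
congr Num.sqrt; apply: (mulfI c2).
by rewrite exprVn mulfV// expr2 -mulrA.
Qed.

Lemma cauchy_schwarz u x : dot u x ^+ 2 <= dot u u * dot x x.
Proof. by have := sqr_ge0 (u.1 * x.2 - u.2 * x.1); rewrite /dot; nra. Qed.

Lemma dot_le_eucl_norm u x : unit_circle u -> `|dot u x| <= eucl_norm x.
Proof.
move=> /unit_circleE u1; rewrite eucl_norm_ge// real_normK ?num_real//.
by have := cauchy_schwarz u x; rewrite u1 mul1r.
Qed.

Lemma continuous_dot u : continuous (dot u).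
Proof.
move=> x; apply: cvgD; apply: cvgM; try exact: cvg_cst.
  exact: cvg_fst.
exact: cvg_snd.
Qed.

Lemma measurable_dot u : measurable_fun [set: P] (dot u).
Proof.
by apply: measurable_funD; apply: measurable_funM => //; exact: measurable_cst.
Qed.

Definition orthonormal_pair e e' := [/\ dot e e = 1, dot e' e' = 1 & dot e e' = 0].

Lemma orthonormal_pair_ex e : dot e e = 1 ->
  exists2 e', orthonormal_pair e e' & orthonormal_pair e (- e').
Proof.
move=> e1; exists (- e.2, e.1); split => //; move: e1; rewrite /dot/= => e1;
  by rewrite -?e1; ring.
Qed.

Section frame.
Variables (e e' : P) (ee' : orthonormal_pair e e').

(** Parseval's identity: e' is one of the two quarter turns of e. *)
Lemma dot_frame x y : dot x y = dot e x * dot e y + dot e' x * dot e' y.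
Proof.
case: ee'; rewrite /dot; case: e e' => [a b] [c d]/= h1 h2 h3.
(* D = 1 or D = - 1 says which quarter turn of e = (a, b) is e' = (c, d). *)
pose D := a * d - b * c.
have cE : c = - D * b.
  rewrite /D; transitivity (c * (a * a + b * b)); first by rewrite h1 mulr1.
  transitivity (a * (a * c + b * d) - (a * d - b * c) * b); first by ring.
  by rewrite h3; ring.
have dE : d = D * a.
  rewrite /D; transitivity (d * (a * a + b * b)); first by rewrite h1 mulr1.
  transitivity (b * (a * c + b * d) + (a * d - b * c) * a); first by ring.
  by rewrite h3; ring.
have D1 : D * D = 1.
  transitivity (D * D * (a * a + b * b)); first by rewrite h1 mulr1.
  by rewrite -h2 [in RHS]cE [in RHS]dE; ring.
rewrite cE dE; transitivity ((a * a + b * b) * (x.1 * y.1 + x.2 * y.2)).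
  by rewrite h1 mul1r.
transitivity ((a * x.1 + b * x.2) * (a * y.1 + b * y.2) +
  (D * D) * (a * x.2 - b * x.1) * (a * y.2 - b * y.1)).
  by rewrite D1; ring.
by ring.
Qed.

Lemma frame_ext x y : dot e x = dot e y -> dot e' x = dot e' y -> x = y.
Proof.
move=> h h'.
have hu u : dot u x = dot u y by rewrite !(dot_frame u) h h'.
have := hu (1, 0); have := hu (0, 1); rewrite /dot/= !mul0r !mul1r !add0r !addr0.
by case: x y {h h' hu} => [? ?] [? ?]/= -> ->.
Qed.

End frame.

(** An open set is the union of the rational boxes it contains, so the product
    sigma-algebra contains the Borel sets of the plane. *)
Lemma open_measurable_plane (U : set P) : open U -> measurable U.
Proof.
move=> oU.
pose box (a b c d : R) : set P := `]a, b[ `*` `]c, d[.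
rewrite (_ : U = \bigcup_(a in [set: rat]) \bigcup_(b in [set: rat])
  \bigcup_(c in [set: rat]) \bigcup_(d in [set: rat])
  (if `[< box (ratr a) (ratr b) (ratr c) (ratr d) `<=` U >]
   then box (ratr a) (ratr b) (ratr c) (ratr d) else set0)).
  do 4 (apply: bigcupT_measurable_rat => ?).
  by case: ifP => // _; exact: measurableX.
apply/seteqP; split => [[x y] Uxy|]; last first.
  by move=> z [a _ [b _ [c _ [d _]]]]; case: asboolP => // h /h.
have := oU; rewrite openE => /(_ _ Uxy) /nbhs_ballP[r /= r0 rU].
have rat_near (p q : R) : p < q -> exists a : rat, p < ratr a < q.
  by move=> /rat_in_itvoo[a]; rewrite in_itv/= => ha; exists a.
have [|a /andP[a1 a2]] := rat_near (x - r) x; first by rewrite ltrBlDr ltrDl.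
have [|b /andP[b1 b2]] := rat_near x (x + r); first by rewrite ltrDl.
have [|c /andP[c1 c2]] := rat_near (y - r) y; first by rewrite ltrBlDr ltrDl.
have [|d /andP[d1 d2]] := rat_near y (y + r); first by rewrite ltrDl.
exists a => //; exists b => //; exists c => //; exists d => //.
rewrite asboolT; first by split => /=; rewrite in_itv/= ?a2 ?b1 ?c2 ?d1.
move=> [s t] [/=]; rewrite !in_itv/= => /andP[s1 s2] /andP[t1 t2].
by apply: rU; split; rewrite /ball/= ltr_norml; apply/andP; split; lra.
Qed.

End plane.

(** * Support points of a compact set *)

Section support_points.
Context {R : realType}.
Local Notation P := (R * R)%type.
Implicit Types (K : set P) (u v x y z e : P).

Definition supports K u x := K x /\ forall y, K y -> dot u y <= dot u x.

Lemma convex_body_comb K x y (l : R) : convex_body K -> K x -> K y -> 0 <= l <= 1 ->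
  K (l *: x + (1 - l) *: y).
Proof.
move=> [_ cK _] Kx Ky /andP[l0 l1].
by have := cK x y (Itv01 l0 l1); rewrite !inE; exact.
Qed.

Lemma supports_ex K u : compact K -> K !=set0 -> exists x, supports K u x.
Proof.
move=> cK K0; have [|x xK xmax] := @compact_EVT_max P R (dot u) K K0 cK.
  by apply: continuous_subspaceT; exact: continuous_dot.
by exists x; split; [rewrite inE in xK|move=> y Ky; apply: xmax; rewrite inE].
Qed.

Lemma support_functionE K u x : supports K u x -> support_function K u = dot u x.
Proof.
move=> [Kx xmax]; apply/eqP; rewrite eq_le; apply/andP; split.
  by apply: ge_sup; [exists (dot u x), x|move=> _ [y Ky <-]; exact: xmax].
apply: ub_le_sup; last by exists x.
by exists (dot u x) => _ [y Ky <-]; exact: xmax.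
Qed.

Lemma near_translate K x v : nbhs x K -> exists n, K (x + n.+1%:R^-1 *: v).
Proof.
move=> Kx.
have /(_ K Kx)[N _ NK] : x + (n.+1%:R^-1 : R) *: v @[n --> \oo] --> x.
  rewrite -[X in _ --> X]addr0; apply: cvgD; first exact: cvg_cst.
  rewrite -[X in _ --> X](scale0r v); apply: cvgZr_tmp; exact: cvg_harmonic.
by exists N; apply: NK => /=.
Qed.

(** An interior point can be moved in the direction v without leaving K, which
    changes the value of dot v unless v = 0. *)
Lemma convex_body_not_flat K v x : convex_body K ->
  (forall y, K y -> dot v y = dot v x) -> v = 0.
Proof.
move=> [_ _ [c Kc]] flat.
have [n Kn] := near_translate v Kc.
have /eqP := flat _ Kn; rewrite dotDr dotZr flat; last exact: interior_subset.
rewrite -subr_eq0 addrAC subrr add0r mulf_eq0 invr_eq0 pnatr_eq0/=.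
rewrite /dot paddr_eq0 -?expr2 ?sqr_ge0// !sqrf_eq0.
by case: v {flat Kn} => a b /= /andP[/eqP -> /eqP ->].
Qed.

End support_points.

(** * The arc of a convex body above a chord *)

Lemma ratio_itv01 (R : realType) (a b : R) : 0 < b -> 0 <= a <= b -> 0 <= a / b <= 1.
Proof.
by move=> b0 /andP[a0 ab]; rewrite divr_ge0 ?(ltW b0)//= ler_pdivrMr// mul1r.
Qed.

Section top_arc.
Context {R : realType}.
Local Notation P := (R * R)%type.
Implicit Types (x y z : P) (t : R).
Variables (K : set P) (e e' : P).
Hypotheses (bodyK : convex_body K) (ee' : orthonormal_pair e e').

(** Normals are parametrised along a segment instead of by their angle: then
    the support function at [dir t] is a supremum of affine functions of t
    ([dot_dir]), hence convex in t, and the [slope] of a support point in the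
    direction [dir t] is a subgradient of it at t. *)
Definition dir t : P := (1 - t) *: e + t *: e'.

Definition slope x : R := dot e' x - dot e x.

(** In the coordinates [slope] (along e' - e) and [dot e], these are the points
    of K that are highest on their line of constant slope. Testing only the
    translates by (e + e') / (n + 1) makes the set visibly measurable; by
    convexity it excludes all points above. *)
Definition top_arc : set P :=
  [set z | K z /\ forall n, ~ K (z + n.+1%:R^-1 *: (e + e'))].

Lemma dot_dir t x : dot (dir t) x = dot e x + t * slope x.
Proof. by rewrite dotDl !dotZl /slope; ring. Qed.

Lemma dot_dir_dir t : dot (dir t) (dir t) = (1 - t) ^+ 2 + t ^+ 2.
Proof.
have [e1 e'1 eo] := ee'; have eo' : dot e' e = 0 by rewrite dotC.
by rewrite dot_dir /slope /dir !dotDr !dotZr e1 e'1 eo eo'; ring.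
Qed.

Lemma dot_dir_dir_gt0 t : 0 < dot (dir t) (dir t).
Proof. by rewrite dot_dir_dir; nra. Qed.

Lemma slopeB x y : slope (x - y) = slope x - slope y.
Proof. by rewrite /slope !dotBr; ring. Qed.

Lemma slope_frame_ext x y : dot e x = dot e y -> slope x = slope y -> x = y.
Proof.
move=> h; rewrite /slope h => /addIr h'; exact: (frame_ext ee').
Qed.

Lemma slope_comb (l : R) x y :
  slope (l *: x + (1 - l) *: y) = l * slope x + (1 - l) * slope y.
Proof. by rewrite /slope !dotDr !dotZr; ring. Qed.

(** A higher point x of K on the line of z would put some
    z + (e + e') / (n + 1) on the segment from z to x. *)
Lemma top_arc_max z x : top_arc z -> K x -> slope x = slope z -> dot e x <= dot e z.
Proof.
have [e1 e'1 eo] := ee'; have eo' : dot e' e = 0 by rewrite dotC.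
move=> [Kz nK] Kx xz; rewrite leNgt; apply/negP => c0; rewrite -subr_gt0 in c0.
set c := dot e x - dot e z in c0.
have [n nc] : exists n, n.+1%:R^-1 <= c.
  exists (Num.truncn c^-1); rewrite invf_ple ?posrE//.
  by rewrite ltW// truncnS_gt.
apply: (nK n); pose l := n.+1%:R^-1 / c.
have lc : l * c = n.+1%:R^-1 by rewrite divfK ?gt_eqF.
have -> : z + n.+1%:R^-1 *: (e + e') = l *: x + (1 - l) *: z.
  apply: slope_frame_ext.
    by rewrite !dotDr !dotZr dotDr e1 eo -lc /c; ring.
  rewrite slope_comb xz /slope !dotDr !dotZr !dotDr e1 e'1 eo eo'; ring.
by apply: convex_body_comb => //; apply: ratio_itv01 => //; rewrite invr_ge0 ler0n.
Qed.

Lemma top_arc_not_interior z : top_arc z -> ~ K° z.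
Proof. by move=> [_ nK] /(near_translate (e + e'))[n /nK]. Qed.

Lemma top_arc_ex (s : R) x y : K x -> K y -> slope x <= s <= slope y ->
  exists2 z, top_arc z & slope z = s.
Proof.
move=> Kx Ky /andP[xs sy].
have [e1 e'1 eo] := ee'; have eo' : dot e' e = 0 by rewrite dotC.
have [cK _ _] := bodyK.
pose L := K `&` [set z | slope z = s].
have sE : slope = fun z => dot (e' - e) z.
  by apply/funext => z; rewrite /slope /dot/=; ring.
have cL : compact L.
  apply: compact_closedI => //.
  have -> : [set z | slope z = s] = (dot (e' - e)) @^-1` [set s] by rewrite sE.
  apply: (closed_comp (f := dot (e' - e))); last exact: closed_eq.
  by move=> u _; exact: continuous_dot.
have L0 : L !=set0.
  have [xy|xy] := eqVneq (slope x) (slope y).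
    by exists x; split => //=; apply/le_anti; rewrite xs xy sy.
  have d0 : 0 < slope y - slope x.
    by rewrite subr_gt0 lt_neqAle xy (le_trans xs).
  pose l := (s - slope x) / (slope y - slope x).
  have lE : l * (slope y - slope x) = s - slope x by rewrite divfK ?gt_eqF.
  exists (l *: y + (1 - l) *: x); split => /=; last first.
    by rewrite slope_comb; lra.
  by apply: convex_body_comb => //; apply: ratio_itv01 => //; lra.
have [z [[Kz zs] zmax]] := supports_ex e cL L0.
exists z => //; split => // n Kn.
have /zmax : L (z + n.+1%:R^-1 *: (e + e')).
  split => //=; rewrite /slope !dotDr !dotZr !dotDr e1 e'1 eo eo' -[RHS]zs /slope; ring.
by rewrite dotDr dotZr dotDr e1 eo addr0 mulr1 gerDl leNgt invr_gt0 ltr0Sn.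
Qed.

(** As z is highest on its line, the chords from z to the right are no steeper
    than the chords from the left to z. A number between these two families
    of chord slopes is the slope of a supporting line at z; comparing this line
    with those at x and y places its parameter between a and b. *)
Lemma top_arc_supports x y z (a b : R) : supports K (dir a) x -> supports K (dir b) y ->
  top_arc z -> slope x < slope z < slope y ->
  exists2 t, a <= t <= b & supports K (dir t) z.
Proof.
move=> [Kx xmax] [Ky ymax] tz /andP[xz zy]; have [Kz _] := tz.
have cross k k' : K k -> K k' -> slope k' < slope z < slope k ->
    (dot e k - dot e z) * (slope z - slope k') <=
    (dot e z - dot e k') * (slope k - slope z).
  move=> Kk Kk' /andP[k'z zk].
  have d0 : 0 < slope k - slope k' by lra.
  pose l := (slope z - slope k') / (slope k - slope k').
  have lE : l * (slope k - slope k') = slope z - slope k' by rewrite divfK ?gt_eqF.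
  have Km : K (l *: k + (1 - l) *: k').
    by apply: convex_body_comb => //; apply: ratio_itv01 => //; lra.
  have : slope (l *: k + (1 - l) *: k') = slope z by rewrite slope_comb; lra.
  move=> /(top_arc_max tz Km); rewrite !dotDr !dotZr => h.
  have : (slope k - slope k') * (l * dot e k + (1 - l) * dot e k') <=
         (slope k - slope k') * dot e z by rewrite ler_wpM2l// ltW.
  have -> : (slope k - slope k') * (l * dot e k + (1 - l) * dot e k') =
    (l * (slope k - slope k')) * dot e k +
    ((slope k - slope k') - (l * (slope k - slope k'))) * dot e k' by ring.
  by rewrite lE; lra.
pose Q := [set (dot e k - dot e z) / (slope k - slope z) | k in
  [set k | K k /\ slope z < slope k]].
have Qub k' : K k' -> slope k' < slope z ->
    ubound Q ((dot e z - dot e k') / (slope z - slope k')).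
  move=> Kk' k'z _ [k [Kk zk] <-].
  rewrite ler_pdivrMr ?subr_gt0// mulrAC ler_pdivlMr ?subr_gt0//.
  by apply: cross => //; rewrite k'z.
have hsQ : has_sup Q.
  split; last by exists ((dot e z - dot e x) / (slope z - slope x)); exact: Qub.
  by exists ((dot e y - dot e z) / (slope y - slope z)), y.
have sz : supports K (dir (- sup Q)) z.
  split => // k Kk; rewrite !dot_dir.
  have [kz|zk|kz] := ltgtP (slope k) (slope z).
  - have : sup Q <= (dot e z - dot e k) / (slope z - slope k).
      by apply: ge_sup; [case: hsQ|exact: Qub].
    by rewrite ler_pdivlMr ?subr_gt0//; lra.
  - have : (dot e k - dot e z) / (slope k - slope z) <= sup Q.
      by apply: ub_le_sup; [case: hsQ|exists k].
    by rewrite ler_pdivrMr ?subr_gt0//; lra.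
  - by rewrite kz lerD2r; exact: top_arc_max.
exists (- sup Q) => //; apply/andP; split.
  have := xmax _ Kz; have := sz.2 _ Kx; rewrite !dot_dir => h1 h2.
  have : 0 <= (- sup Q - a) * (slope z - slope x) by lra.
  rewrite pmulr_lge0 ?subr_gt0//. lra.
have := ymax _ Kz; have := sz.2 _ Ky; rewrite !dot_dir => h1 h2.
have : 0 <= (b + sup Q) * (slope y - slope z) by lra.
by rewrite pmulr_lge0 ?subr_gt0//; lra.
Qed.

(** Every normal n at z is a multiple of some [dir t'], that is, its component
    A along e + e' is positive: if A <= 0, the combination n - A [dir t] only
    sees the slope, and having points of K on both sides of z it vanishes;
    then n is a nonpositive multiple of [dir t], so either n = 0 or K lies on
    a line. *)
Lemma outer_unit_normal_dir x y z n t : K x -> K y -> slope x < slope z < slope y ->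
  supports K (dir t) z -> outer_unit_normal K z n ->
  exists2 t', n = (eucl_norm (dir t'))^-1 *: dir t' & supports K (dir t') z.
Proof.
have [e1 e'1 eo] := ee'; have eo' : dot e' e = 0 by rewrite dotC.
move=> Kx Ky /andP[xz zy] [Kz zmax] [/unit_circleE n1 nmax].
pose A := dot e n + dot e' n.
have nE k : dot n k = A * dot e k + dot e' n * slope k.
  by rewrite (dot_frame ee') /A /slope; ring.
have [A0|A0] := ltP 0 A.
  pose t' := dot e' n / A.
  have At' : A * t' = dot e' n by rewrite mulrC divfK ?gt_eqF.
  have nA : n = A *: dir t'.
    apply: (frame_ext ee').
      rewrite dotZr [dot e (dir _)]dotC dot_dir /slope e1 eo'.
      have -> : A * (1 + t' * (0 - 1)) = A - A * t' by ring.
      by rewrite At' /A; ring.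
    by rewrite dotZr [dot e' (dir _)]dotC dot_dir /slope e'1 eo -At'; ring.
  exists t'.
    by rewrite {1}nA (@eucl_norm_scaled_unit _ A)// -nA.
  split => // k Kk; have := nmax _ Kk; rewrite dotBr nA !dotZl -mulrBr.
  by rewrite pmulr_rle0// subr_le0.
exfalso; pose g := dot e' n - A * t.
have gk k : K k -> g * (slope k - slope z) <= 0.
  move=> Kk; have := nmax _ Kk; have := zmax _ Kk.
  rewrite dotBr !nE !dot_dir /g => h1 h2.
  have : 0 <= - A * ((dot e z + t * slope z) - (dot e k + t * slope k)).
    by rewrite mulr_ge0 ?oppr_ge0 ?subr_ge0.
  lra.
have g0 : g = 0.
  apply/le_anti/andP; split.
    by have := gk _ Ky; rewrite pmulr_lle0 ?subr_gt0//; lra.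
  by have := gk _ Kx; rewrite nmulr_lle0 ?subr_lt0//; lra.
have c2 : dot e' n = A * t by move: g0; rewrite /g; lra.
have nE' k : dot n k = A * dot (dir t) k by rewrite nE c2 dot_dir; ring.
have AN0 : A != 0.
  by apply/eqP => A00; move: n1; rewrite nE' A00 mul0r => /eqP; rewrite eq_sym oner_eq0.
have : dir t = 0.
  apply: (convex_body_not_flat bodyK (x := z)) => k Kk.
  apply/le_anti; rewrite zmax//=.
  have := nmax _ Kk; rewrite dotBr !nE' -mulrBr nmulr_rle0 ?subr_ge0//.
  by rewrite lt_neqAle AN0.
by move=> d0; have := dot_dir_dir_gt0 t; rewrite d0 dot0r ltxx.
Qed.

Lemma supports_between z k (t t' r : R) : t < r < t' ->
  supports K (dir t) z -> supports K (dir t') z -> supports K (dir r) k -> k = z.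
Proof.
move=> /andP[tr rt'] [Kz zt] [_ zt'] [Kk kr].
have := zt _ Kk; have := zt' _ Kk; have := kr _ Kz; rewrite !dot_dir => h0 h1 h2.
have s0 : slope k - slope z = 0.
  apply/le_anti/andP; split.
    have : (slope k - slope z) * (t' - r) <= 0 by lra.
    by rewrite pmulr_lle0 ?subr_gt0//; lra.
  have : 0 <= (slope k - slope z) * (r - t) by lra.
  by rewrite pmulr_lge0 ?subr_gt0//; lra.
have ks : slope k = slope z by lra.
by apply: slope_frame_ext => //; move: h0 h1; rewrite ks; lra.
Qed.

Lemma support_selection : K !=set0 ->
  exists xi : R -> P, forall t, supports K (dir t) (xi t).
Proof.
have [cK _ _] := bodyK; move=> nK.
have hex t := supports_ex (dir t) cK nK.
by exists (fun t => projT1 (cid (hex t))) => t; case: cid.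
Qed.

(** If z had two normals [dir t] and [dir t'], it would be the only support
    point in all directions in between, hence equal to xi r for a rational r.
    So apart from the countably many points xi r the normal is unique, without
    any appeal to the almost everywhere differentiability of convex functions. *)
Lemma top_arc_regular (xi : R -> P) x y z (a b : R) :
  (forall t, supports K (dir t) (xi t)) ->
  supports K (dir a) x -> supports K (dir b) y ->
  top_arc z -> slope x < slope z < slope y ->
  (forall r : rat, z <> xi (ratr r)) ->
  exists t, [/\ a <= t <= b, supports K (dir t) z, regular_boundary K z &
    gauss_map K z = (eucl_norm (dir t))^-1 *: dir t].
Proof.
move=> xiP xa yb tz xzy zxi; have [Kx _] := xa; have [Ky _] := yb.
have [t tab zt] := top_arc_supports xa yb tz xzy.
have Nt : outer_unit_normal K z ((eucl_norm (dir t))^-1 *: dir t).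
  have d0 : 0 < eucl_norm (dir t) by rewrite sqrtr_gt0 dot_dir_dir_gt0.
  split.
    exact: unit_circle_normalize.
  move=> k Kk; rewrite dotZl dotBr pmulr_rle0 ?invr_gt0// subr_le0.
  by case: zt => _; exact.
have uniq n : outer_unit_normal K z n -> n = (eucl_norm (dir t))^-1 *: dir t.
  move=> /(outer_unit_normal_dir Kx Ky xzy zt)[t' -> zt'].
  suff -> : t' = t by [].
  have contra u v : supports K (dir u) z -> supports K (dir v) z -> u < v -> False.
    move=> zu zv /rat_in_itvoo[r]; rewrite in_itv/= => urv.
    by apply: (zxi r); rewrite (supports_between urv zu zv (xiP _)).
  by apply/eqP; case: (ltgtP t' t) => // [/contra|/contra] h; exfalso; apply: h.
exists t; split => //.
  split; first by split; [apply: subset_closure; case: tz|exact: top_arc_not_interior].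
  by exists ((eucl_norm (dir t))^-1 *: dir t); split => // n /uniq.
rewrite /gauss_map; apply: uniq; apply: (xgetPex 0).
by exists ((eucl_norm (dir t))^-1 *: dir t).
Qed.

Lemma measurable_top_arc : measurable top_arc.
Proof.
have [cK _ _] := bodyK.
have mK : measurable K.
  rewrite -[K]setCK; apply: measurableC; apply: open_measurable_plane.
  by apply: closed_openC; apply: compact_closed => //; exact: norm_hausdorff.
rewrite (_ : top_arc = K `&`
  \bigcap_n ~` ((fun z => z + n.+1%:R^-1 *: (e + e')) @^-1` K)).
  apply: measurableI => //; apply: bigcapT_measurable => n; apply: measurableC.
  rewrite -[X in measurable X]setTI; apply: measurable_fun_pair => //.
  - by apply: measurable_funD.
  - by apply: measurable_funD.
by apply/seteqP; split => z [Kz h]; split => // n; [move=> _|]; apply: h.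
Qed.

End top_arc.

(** * Integral bounds and arcs of unit normals *)

Section integral_bounds.
Local Open Scope ereal_scope.
Context d (T : measurableType d) (R : realType) (mu : {measure set T -> \bar R}).

(** c times the indicator of B is a simple function below F on D, and the
    integral of a nonnegative function is the supremum over such functions. The
    bound therefore applies to curvature measures, whose domain and integrand
    involve the Gauss map, the measurability of which is not established. *)
Lemma le_integral_superset (D B : set T) (F : T -> R) (c : R) :
  measurable B -> B `<=` D -> (0 <= c)%R -> (forall x, D x -> (0 <= F x)%R) ->
  (forall x, B x -> (c <= F x)%R) -> c%:E * mu B <= \int[mu]_(x in D) (F x)%:E.
Proof.
move=> mB BD c0 F0 cF.
rewrite -(setIT B) -integral_indic// -ge0_integralZl//; last first.
  exact/measurable_EFinP.
rewrite ge0_integralTE; last by move=> x; rewrite -EFinM lee_fin mulr_ge0.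
rewrite ge0_integralE; last by move=> x /F0; rewrite lee_fin.
apply: ereal_sup_le => _ [h /= hc <-]; exists h => // x; apply: le_trans (hc x) _.
rewrite /patch indicE; case: ifPn => [xD|/negP xD]; last first.
  rewrite memNset ?mulr0 ?mule0// => /BD; rewrite -inE; exact: xD.
case: (boolP (x \in B)) => [xB|_]; last first.
  by rewrite mule0 lee_fin F0//; rewrite inE in xD.
by rewrite mule1 lee_fin cF//; rewrite inE in xB.
Qed.

(** Replacing f by its truncation between a and b turns the almost everywhere
    bounds into pointwise ones. *)
Lemma integral_ae_bounds (f : T -> R) (D : set T) (a b : R) :
  measurable_fun setT f -> measurable D -> (0 <= a <= b)%R ->
  {ae mu, forall x, (a <= f x <= b)%R} ->
  a%:E * mu D <= \int[mu]_(x in D) (f x)%:E <= b%:E * mu D.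
Proof.
move=> mf mD /andP[a0 ab] fab.
pose g x := Num.max a (Num.min (f x) b).
have mg : measurable_fun setT g.
  by apply: measurable_maxr => //; apply: measurable_minr.
have ag x : (a <= g x)%R by rewrite le_max lexx.
have gb x : (g x <= b)%R by rewrite ge_max ab ge_min lexx orbT.
have mgD : measurable_fun D (EFin \o g).
  by apply/measurable_EFinP; exact: measurable_funTS.
have -> : \int[mu]_(x in D) (f x)%:E = \int[mu]_(x in D) (g x)%:E.
  apply: ae_eq_integral => //.
    by apply/measurable_EFinP; exact: measurable_funTS.
  apply: filterS fab => x /andP[h1 h2] _; congr EFin.
  by rewrite /g; rewrite (min_idPl h2) (max_idPr h1).
rewrite -!integral_cst//; apply/andP; split; apply: ge0_le_integral => //.
- by move=> x _; rewrite /= lee_fin.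
- by move=> x _; rewrite lee_fin (le_trans a0).
- by move=> x _; rewrite /= lee_fin.
Qed.

End integral_bounds.

Section normal_arc.
Context {R : realType}.
Local Notation P := (R * R)%type.
Implicit Types (x y z u : P) (s t : R).
Variables (e e' : P).
Hypotheses (ee' : orthonormal_pair e e').

Definition udir t : P := (eucl_norm (dir e e' t))^-1 *: dir e e' t.

Lemma norm_dir_gt0 t : 0 < eucl_norm (dir e e' t).
Proof. by rewrite sqrtr_gt0 (dot_dir_dir_gt0 ee'). Qed.

(** The arc of the unit normals [udir t] with a <= t <= b ([normal_arcP]). It is
    described by linear inequalities, from which measurability is immediate;
    they express that t = dot e' u / dot (e + e') u lies between a and b. *)
Definition normal_arc (a b : R) : set P := [set u | [/\ unit_circle u,
  0 < dot (e + e') u, 0 <= dot (e' - a *: (e + e')) u &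
  0 <= dot (b *: (e + e') - e') u]].

Lemma dot_frame_udir t : dot (e + e') (udir t) = (eucl_norm (dir e e' t))^-1 /\
  dot e' (udir t) = t * (eucl_norm (dir e e' t))^-1.
Proof.
have [e1 e'1 eo] := ee'; have eo' : dot e' e = 0 by rewrite dotC.
by split; rewrite /udir ?dotDl !dotZr ![dot _ (dir _ _ _)]dotC !(dot_dir e e') /slope
   ?e1 e'1 ?eo ?eo'; ring.
Qed.

Lemma normal_arcP (a b : R) : normal_arc a b = udir @` `[a, b].
Proof.
have [e1 e'1 eo] := ee'; have eo' : dot e' e = 0 by rewrite dotC.
apply/seteqP; split => [u [/unit_circleE u1 c0 ha hb]|_ [t /= tab <-]].
  have cE : dot (e + e') u = dot e u + dot e' u by rewrite dotDl.
  move: ha hb; rewrite !dotBl !dotZl !subr_ge0 => ha hb.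
  set c := dot (e + e') u in c0 ha hb cE.
  exists (dot e' u / c); first by rewrite /= in_itv/= ler_pdivlMr// ha ler_pdivrMr.
  set t := dot e' u / c.
  have ct : t * c = dot e' u by rewrite divfK ?gt_eqF.
  have uE : u = c *: dir e e' t.
    apply: (slope_frame_ext ee'); rewrite ?/slope !dotZr ![dot _ (dir _ _ _)]dotC
      !(dot_dir e e') /slope e1 ?e'1 ?eo ?eo'; lra.
  by rewrite /udir (@eucl_norm_scaled_unit _ c) -?uE.
move: tab; rewrite in_itv/= => /andP[at_ tb].
have [hc hd] := dot_frame_udir t; have n0 := norm_dir_gt0 t.
split.
- exact: unit_circle_normalize.
- by rewrite hc invr_gt0.
- by rewrite dotBl dotZl hc hd subr_ge0 ler_pM2r ?invr_gt0.
- by rewrite dotBl dotZl hc hd subr_ge0 ler_pM2r ?invr_gt0.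
Qed.

Lemma measurable_normal_arc (a b : R) : measurable (normal_arc a b).
Proof.
have mge (v : P) : measurable [set u | 0 <= dot v u].
  rewrite (_ : [set u | _] = setT `&` dot v @^-1` `[0, +oo[).
    by apply: measurable_dot.
  by rewrite setTI; apply/seteqP; split => u /=; rewrite in_itv/= andbT.
have mgt (v : P) : measurable [set u | 0 < dot v u].
  rewrite (_ : [set u | _] = setT `&` dot v @^-1` `]0, +oo[).
    by apply: measurable_dot.
  by rewrite setTI; apply/seteqP; split => u /=; rewrite in_itv/= andbT.
rewrite (_ : normal_arc a b = unit_circle `&` [set u | 0 < dot (e + e') u] `&`
  [set u | 0 <= dot (e' - a *: (e + e')) u] `&`
  [set u | 0 <= dot (b *: (e + e') - e') u]).
  by do 3 (apply: measurableI => //); exact: measurable_unit_circle.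
by apply/seteqP; split => u /= => [[? ? ? ?]|[[[? ?] ?] ?]].
Qed.

(** For vectors v, w of norms A, B the squared distance of v / A and w / B is at
    most |v - w|^2 / (A B); here |v - w|^2 = 2 (s - t)^2 and A B >= 1 / 2. *)
Lemma udir_lipschitz s t : eucl_norm (udir s - udir t) <= 2 * `|s - t|.
Proof.
have [e1 e'1 eo] := ee'; have eo' : dot e' e = 0 by rewrite dotC.
rewrite eucl_norm_le ?mulr_ge0// exprMn real_normK ?num_real//.
pose A := eucl_norm (dir e e' s); pose B := eucl_norm (dir e e' t).
have A0 : 0 < A by exact: norm_dir_gt0.
have B0 : 0 < B by exact: norm_dir_gt0.
have AE : A ^+ 2 = (1 - s) ^+ 2 + s ^+ 2 by rewrite sqr_eucl_norm (dot_dir_dir ee').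
have BE : B ^+ 2 = (1 - t) ^+ 2 + t ^+ 2 by rewrite sqr_eucl_norm (dot_dir_dir ee').
have cE : dot (dir e e' s) (dir e e' t) = (1 - s) * (1 - t) + s * t.
  by rewrite dot_dir /slope /dir !dotDr !dotZr e1 e'1 eo eo'; ring.
have AB : 1 <= 2 * (A * B).
  have A2 : 1 <= 2 * A ^+ 2 by rewrite AE; have := sqr_ge0 (2 * s - 1); lra.
  have B2 : 1 <= 2 * B ^+ 2 by rewrite BE; have := sqr_ge0 (2 * t - 1); lra.
  have : 1 <= (2 * (A * B)) ^+ 2 by rewrite !exprMn; nra.
  by rewrite expr_ge1// !mulr_ge0 ?ltW.
have -> : dot (udir s - udir t) (udir s - udir t) =
    2 - 2 * dot (dir e e' s) (dir e e' t) / (A * B).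
  transitivity (A ^- 2 * dot (dir e e' s) (dir e e' s) +
     B ^- 2 * dot (dir e e' t) (dir e e' t)
     - 2 * dot (dir e e' s) (dir e e' t) / (A * B)).
    have dotBB (v w : P) : dot (v - w) (v - w) = dot v v + dot w w - 2 * dot v w.
      by rewrite /dot/=; ring.
    by rewrite dotBB /udir -/A -/B !dotZl !dotZr -!exprVn [(A * B)^-1]invfM; ring.
  by rewrite -!sqr_eucl_norm -/A -/B !mulVf ?expf_eq0 ?gt_eqF//; ring.
rewrite lerBlDr -lerBlDl ler_pdivlMr ?mulr_gt0//.
have h : 2 * dot (dir e e' s) (dir e e' t) = A ^+ 2 + B ^+ 2 - 2 * (s - t) ^+ 2.
  by rewrite cE AE BE; ring.
rewrite h; have := sqr_ge0 (s - t); have := sqr_ge0 (A - B); nra.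
Qed.

End normal_arc.

(** * Slowly varying slopes of a convex function *)

(** The tangent inequality at b for the concave power p, multiplied by
    b^(1 - p) so that only positive exponents occur; it is Young's inequality. *)
Lemma powR_tangent (R : realType) (p a b : R) : 0 < p -> p < 1 -> 0 < a -> 0 < b ->
  p * (b - a) <= (b `^ p - a `^ p) * b `^ (1 - p).
Proof.
move=> p0 p1 a0 b0; have p1' : 0 < 1 - p by rewrite subr_gt0.
have -> : (b `^ p - a `^ p) * b `^ (1 - p) = b - a `^ p * b `^ (1 - p).
  rewrite mulrBl -powRD; last by rewrite (gt_eqF b0) implybT.
  by rewrite subrKC powRr1// ltW.
have := @conjugate_powR R (a `^ p) (b `^ (1 - p)) p^-1 (1 - p)^-1 (powR_ge0 _ _)
  (powR_ge0 _ _).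
rewrite !invr_gt0 !invrK subrKC => /(_ p0 p1' erefl).
rewrite -!powRrM !mulfV ?gt_eqF// (powRr1 (ltW a0)) (powRr1 (ltW b0)); lra.
Qed.

(** Discrete form of the following computation. Let h be convex and positive
    with h'' h^(1 - p) <= c Lambda. As long as h' <= - 3 D / 4, one has
    h'' <= - kappa (h^p)' with kappa of order Lambda / (p D), so h' + kappa h^p
    is nonincreasing. It starts at - D + kappa D^p, and kappa D^p <= D / 8 if D
    is large; hence h' <= - 7 D / 8 persists and h drops from D to a negative
    value before 3 / 2. Here sg is a selection of subgradients of h, and
    [increment] is the integrated differential inequality, available only in
    the range of slopes below - 3 D / 4. *)
Section slow_slope.
Context {R : realType}.
Variables (p Lambda D : R) (h sg : R -> R).
Hypotheses (p_gt0 : 0 < p) (p_lt1 : p < 1) (Lambda_ge1 : 1 <= Lambda).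
Hypothesis D_large : 192 * Lambda < p * D.
Hypothesis subgradient : forall t r, h r + (t - r) * sg r <= h t.
Hypothesis sg_bounded : forall t, `|sg t| <= 2 * D.
Hypothesis increment : forall a b s m : R, 0 <= a <= b -> b <= 3 / 2 ->
  s <= sg b -> s <= - (3 / 4 * D) -> 0 <= m -> (forall t, a <= t <= b -> m <= h t) ->
  (s - sg a) * (m / 2) `^ (1 - p) <= 4 * Lambda * (b - a).
Hypotheses (h_start : h 0 = D) (sg_start : sg 0 = - D).
Implicit Types (a b t r m : R).

Let D_gt : 192 < D.
Proof.
have D0 : 0 < D by rewrite -(pmulr_rgt0 _ p_gt0); move: D_large Lambda_ge1; lra.
have : 0 <= (1 - p) * D by rewrite mulr_ge0 ?subr_ge0 ?ltW.
by move: D_large Lambda_ge1; lra.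
Qed.

Let D_gt0 : 0 < D. Proof. exact: lt_trans D_gt. Qed.

Let Lambda_gt0 : 0 < Lambda. Proof. exact: lt_le_trans Lambda_ge1. Qed.

Lemma subgradient_lipschitz t r : `|h t - h r| <= 2 * D * `|t - r|.
Proof.
have h1 := subgradient t r; have h2 := subgradient r t.
have b1 : `|(t - r) * sg r| <= 2 * D * `|t - r|.
  by rewrite normrM [leLHS]mulrC ler_wpM2r.
have b2 : `|(r - t) * sg t| <= 2 * D * `|t - r|.
  by rewrite normrM [leLHS]mulrC [`|r - t|]distrC ler_wpM2r.
move: b1 b2; rewrite !ler_norml => /andP[b1 b1'] /andP[b2 b2'].
by apply/andP; split; lra.
Qed.

Lemma positive_lower_bound a b : a <= b -> (forall t, a <= t <= b -> 0 < h t) ->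
  exists2 m : R, 0 < m & forall t, a <= t <= b -> m <= h t.
Proof.
move=> ab hpos; have hc : {within `[a, b], continuous h}.
  apply: continuous_subspaceT => t; apply/cvgrPdist_lt => eps eps0.
  near=> r; apply: (le_lt_trans (subgradient_lipschitz _ _)).
  rewrite mulrC -ltr_pdivlMr ?mulr_gt0//.
  by near: r; apply: cvgr_dist_lt; rewrite ?divr_gt0 ?mulr_gt0//.
have [c c01 cmin] := EVT_min ab hc.
exists (h c); first by apply: hpos; rewrite in_itv in c01.
by move=> t t01; apply: cmin; rewrite in_itv.
Unshelve. all: by end_near. Qed.

(** Large enough to absorb the constants of [energy_step], and small enough
    that kappa D^p <= D / 8. *)
Let kappa := 24 * Lambda / (p * D).

Let kappaE : kappa * (p * D) = 24 * Lambda.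
Proof. by rewrite /kappa divfK// mulf_neq0// gt_eqF. Qed.

Let kappa_ge0 : 0 <= kappa.
Proof. by rewrite /kappa divr_ge0// mulr_ge0// ltW. Qed.

Let kappa_le : kappa * D `^ p <= D / 8.
Proof.
have Dp : D `^ p <= D by rewrite ler1_powR ?(ltW p_lt1)//; move: D_gt; lra.
have : kappa * D `^ p <= kappa * D by rewrite ler_wpM2l.
have : p * (kappa * D) <= p * (D / 8).
  rewrite (_ : p * (kappa * D) = 24 * Lambda); last by rewrite -kappaE; ring.
  by move: D_large; lra.
by rewrite ler_pM2l//; lra.
Qed.

(** A crude bound which confines the slope to the range where [increment]
    applies: in a short step it cannot gain D / 8. *)
Lemma steep_after_step a b m : 0 <= a <= b -> b <= 3 / 2 -> 0 < m ->
  (forall t, 0 <= t <= 3 / 2 -> m <= h t) ->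
  4 * Lambda * (b - a) < D / 8 * (m / 2) `^ (1 - p) ->
  sg a <= - (7 / 8 * D) -> sg b < - (3 / 4 * D).
Proof.
move=> /andP[a0 ab] b1 m0 mh small sa; rewrite ltNge; apply/negP => sb.
have : (- (3 / 4 * D) - sg a) * (m / 2) `^ (1 - p) <= 4 * Lambda * (b - a).
  apply: increment; rewrite ?a0 ?(ltW m0)// => t /andP[at_ tb].
  by apply: mh; apply/andP; split; lra.
apply/negP; rewrite -ltNge; apply: (lt_le_trans small).
by rewrite ler_wpM2r ?powR_ge0//; lra.
Qed.

(** [increment] bounds the gain of slope by (b - a) times a multiple of
    Lambda (h b)^(p - 1), while h decreases by at least 3 D (b - a) / 4, so that
    h^p decreases by at least a multiple of D (b - a) (h a)^(p - 1). The two
    powers of h are comparable since h a <= 2 h b. *)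
Lemma energy_step a b : 0 <= a < b -> b <= 3 / 2 -> 0 < h b ->
  h a <= 2 * h b -> sg b <= - (3 / 4 * D) ->
  sg b - sg a <= kappa * (h a `^ p - h b `^ p).
Proof.
move=> /andP[a0 ab] b1 hb0 hab2 sb.
have L0 := Lambda_gt0; have D0 := D_gt0; have ba0 : 0 < b - a by rewrite subr_gt0.
have h_ge_hb t : a <= t <= b -> h b <= h t.
  move=> /andP[_ tb]; apply: le_trans (subgradient t b).
  by rewrite lerDl mulr_le0// ?subr_le0//; lra.
have hab : h b + 3 / 4 * D * (b - a) <= h a.
  have := subgradient a b.
  have : 0 <= (b - a) * (- (3 / 4 * D) - sg b) by rewrite mulr_ge0 ?(ltW ba0)//; lra.
  lra.
have ha0 : 0 < h a.
  by apply: (lt_le_trans hb0); apply: h_ge_hb; rewrite lexx ltW.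
have hap : 0 < h a `^ (1 - p) by rewrite powR_gt0.
have increment_a : (sg b - sg a) * h a `^ (1 - p) <= 16 * Lambda * (b - a).
  have [s0|s0] := leP (sg b) (sg a).
    apply: (@le_trans _ _ 0); last by rewrite !mulr_ge0// ltW.
    by rewrite mulr_le0_ge0 ?powR_ge0// subr_le0.
  (* h b / 2 >= h a / 4, and 4^-(1 - p) >= 4^-1. *)
  have quarter : 4^-1 * h a `^ (1 - p) <= (h b / 2) `^ (1 - p).
    apply: (@le_trans _ _ ((4^-1 * h a) `^ (1 - p))).
      rewrite powRM ?(ltW ha0)// ler_wpM2r ?powR_ge0//.
      by apply: ger1_powR; [apply/andP; split; lra|rewrite gerBl ltW].
    apply: ge0_ler_powR; rewrite ?subr_ge0 ?(ltW p_lt1) ?nnegrE//; lra.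
  have : (sg b - sg a) * (4^-1 * h a `^ (1 - p)) <=
         (sg b - sg a) * (h b / 2) `^ (1 - p).
    by rewrite ler_wpM2l// subr_ge0 ltW.
  have : (sg b - sg a) * (h b / 2) `^ (1 - p) <= 4 * Lambda * (b - a).
    by apply: increment; rewrite ?a0 ?(ltW ab) ?(ltW hb0).
  lra.
rewrite -(ler_pM2r hap); apply: (le_trans increment_a).
rewrite -[leRHS]mulrA; apply: (@le_trans _ _ (kappa * (p * (h a - h b)))); last first.
  by rewrite ler_wpM2l//; exact: powR_tangent.
apply: (@le_trans _ _ (kappa * (p * (3 / 4 * D * (b - a))))).
  have -> : kappa * (p * (3 / 4 * D * (b - a))) = 18 * Lambda * (b - a).
    transitivity (kappa * (p * D) * (3 / 4 * (b - a))); first by ring.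
    by rewrite kappaE; field.
  by rewrite ler_wpM2r ?(ltW ba0)// ler_wpM2r ?(ltW L0)// ler_nat.
by rewrite ler_wpM2l// ler_wpM2l ?(ltW p_gt0)//; lra.
Qed.

Lemma energy_invariant m (d : R) n : 0 < m -> (forall t, 0 <= t <= 3 / 2 -> m <= h t) ->
  0 < d -> 4 * D * d <= m -> 4 * Lambda * d < D / 8 * (m / 2) `^ (1 - p) ->
  n%:R * d <= 3 / 2 ->
  sg (n%:R * d) + kappa * h (n%:R * d) `^ p <= - D + kappa * D `^ p.
Proof.
move=> m0 mh d0 small1 small2.
elim: n => [|n ih] nd; first by rewrite mul0r h_start sg_start.
set b := n.+1%:R * d in nd *; set a := n%:R * d in ih.
have ba : b - a = d by rewrite /b /a -natr1; ring.
have a0 : 0 <= a by rewrite mulr_ge0// ltW.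
have ab : a < b by rewrite -subr_gt0 ba.
have {}ih := ih (le_trans (ltW ab) nd).
have sa : sg a <= - (7 / 8 * D).
  have : 0 <= kappa * h a `^ p by rewrite mulr_ge0// powR_ge0.
  by move: kappa_le; lra.
have sb : sg b < - (3 / 4 * D).
  by apply: (steep_after_step _ nd m0 mh _ sa); rewrite ?ba// a0 ltW.
have mb : m <= h b by apply: mh; rewrite nd (le_trans a0)// ltW.
suff : sg b - sg a <= kappa * (h a `^ p - h b `^ p) by lra.
apply: energy_step; rewrite ?a0 ?(ltW sb)//; first by exact: lt_le_trans mb.
have := subgradient_lipschitz a b.
by rewrite [`|a - b|]distrC ba (gtr0_norm d0) ler_norml => /andP[_]; lra.
Qed.

Lemma subgradient_zero : exists2 t : R, 0 <= t <= 3 / 2 & h t <= 0.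
Proof.
apply: contrapT => noz; have L0 := Lambda_gt0; have D0 := D_gt0.
have hpos t : 0 <= t <= 3 / 2 -> 0 < h t.
  by move=> t01; rewrite ltNge; apply/negP => ht0; apply: noz; exists t.
have [|m m0 mh] := positive_lower_bound _ hpos; first by rewrite divr_ge0.
(* Steps shorter than d0 are small enough for energy_invariant. *)
pose d0 := Num.min (m / (4 * D)) (D / 8 * (m / 2) `^ (1 - p) / (4 * Lambda)).
have d00 : 0 < d0.
  by rewrite lt_min !divr_gt0 ?mulr_gt0 ?divr_gt0 ?powR_gt0 ?divr_gt0.
pose N := Num.truncn (3 / 2 / d0).
pose d : R := 3 / 2 / N.+1%:R.
have NE : N.+1%:R * d = 3 / 2 by rewrite mulrC divfK.
have dd0 : d < d0.
  by rewrite /d ltr_pdivrMr// [ltRHS]mulrC -ltr_pdivrMr// truncnS_gt.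
have : sg (N.+1%:R * d) + kappa * h (N.+1%:R * d) `^ p <= - D + kappa * D `^ p.
  move: dd0; rewrite lt_min !ltr_pdivlMr ?mulr_gt0// => /andP[d1 d2].
  apply: energy_invariant m0 mh _ _ _ _; rewrite ?NE ?divr_gt0//; lra.
rewrite NE => last_step.
have : 0 <= kappa * h (3 / 2) `^ p by rewrite mulr_ge0// powR_ge0.
have := subgradient 0 (3 / 2); rewrite h_start.
have : 0 < h (3 / 2) by apply: hpos; apply/andP; split; lra.
by move: kappa_le; lra.
Qed.

End slow_slope.

(** * What the curvature bounds say about a body *)

Section arc_estimate.
Context {R : realType}.
Local Notation P := (R * R)%type.
Variables (p q Lambda : R) (f : P -> R) (K : set P).
Hypotheses (p_gt0 : 0 < p) (p_lt1 : p < 1) (q_ge2 : 2 <= q) (Lambda_ge1 : 1 <= Lambda).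
Hypotheses (mf : measurable_fun setT f)
  (f_bounds : {ae arclength, forall u, Lambda^-1 <= f u <= Lambda}).
Hypotheses (bodyK : convex_body K) (K0 : K 0).
Hypothesis curvatureK : forall omega : set P, measurable omega ->
  omega `<=` unit_circle ->
  lp_dual_curvature p q K omega = (\int[arclength]_(u in omega) (f u)%:E)%E.

Let Lambda_gt0 : 0 < Lambda. Proof. exact: lt_le_trans Lambda_ge1. Qed.

Lemma curvature_bounds (omega : set P) : measurable omega -> omega `<=` unit_circle ->
  (Lambda^-1%:E * hausdorff1 omega <= lp_dual_curvature p q K omega <=
   Lambda%:E * hausdorff1 omega)%E.
Proof.
move=> mo oS; rewrite curvatureK//.
have -> : hausdorff1 omega = arclength omega.
  by rewrite -[in LHS](setIidl oS).
apply: integral_ae_bounds => //; rewrite invr_ge0 ltW//=.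
by rewrite (le_trans _ Lambda_ge1)// invf_le1.
Qed.

(** Normals u with dot u <= 0 on K support K at height 0, since K contains the
    origin. The factor (x . N)^(1 - p) then vanishes, so such normals carry no
    curvature, whereas f >= 1 / Lambda. *)
Lemma support_zero_null (omega : set P) : measurable omega -> omega `<=` unit_circle ->
  (forall u z, omega u -> K z -> dot u z <= 0) -> (hausdorff1 omega <= 0)%E.
Proof.
move=> mo oS o0; have /andP[lower _] := curvature_bounds mo oS.
have K_zero : lp_dual_curvature p q K omega = 0%E.
  apply: integral0_eq => z [[[cKz _] [n [nz _]]] oz]; congr EFin.
  have [_ /(_ _ K0)] : outer_unit_normal K z (gauss_map K z).
    by apply: (xgetPex 0); exists n.
  rewrite sub0r -[- z]scaleN1r dotZr mulN1r oppr_le0 => g0.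
  have Kz : K z.
    have [cK _ _] := bodyK.
    by rewrite (closure_id K).1//; apply: compact_closed => //; exact: norm_hausdorff.
  have -> : dot z (gauss_map K z) = 0.
    by rewrite dotC; apply/le_anti; rewrite g0 andbT o0.
  by rewrite powR0 ?mulr0// subr_eq0 gt_eqF.
move: lower; rewrite K_zero pmule_rle0// lte_fin invr_gt0.
exact: Lambda_gt0.
Qed.

Lemma measurable_plane_set1 (z : P) : measurable [set z].
Proof.
rewrite (_ : [set z] = [set z.1] `*` [set z.2]); first exact: measurableX.
by apply/seteqP; split => [_ ->//|[a b] [/= -> ->]]; case: z.
Qed.

Variables (e e' : P).
Hypothesis ee' : orthonormal_pair e e'.
Local Notation dir := (dir e e').
Local Notation slope := (slope e e').
Implicit Types (x y z : P) (a b s t m : R).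

Lemma slope_lipschitz x y : `|slope x / 2 - slope y / 2| <= eucl_norm (x - y).
Proof.
have [/unit_circleE e1 /unit_circleE e'1 _] := ee'.
rewrite -mulrBl -(slopeB e e') /slope normrM [`|2^-1|]ger0_norm// ler_pdivrMr//.
apply: (le_trans (ler_normB _ _)).
have := dot_le_eucl_norm (x - y) e1; have := dot_le_eucl_norm (x - y) e'1; lra.
Qed.

Lemma norm_dir_le2 t : 0 <= t <= 3 / 2 -> eucl_norm (dir t) <= 2.
Proof. by move=> /andP[t0 t1]; rewrite eucl_norm_le// (dot_dir_dir ee'); nra. Qed.

(** The inequality h'' h^(1 - p) <= 4 Lambda (up to the normalisation of
    [dir t]) for h(t) = dot (dir t) z at support points z, integrated over
    [a, b] and restricted to slopes below s. The boundary points with slope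
    between those of x and s have normals in the arc from a to b, whose
    curvature is at most 2 Lambda (b - a); their H^1 measure is at least half
    the range of slopes, and the integrand is at least (m / 2)^(1 - p) there,
    as |z| >= 1 and q >= 2. *)
Lemma slope_increment a b s m x y :
  supports K (dir a) x -> supports K (dir b) y -> 0 <= a <= b -> b <= 3 / 2 ->
  s <= slope y -> 0 <= m ->
  (forall t z, a <= t <= b -> supports K (dir t) z -> m <= dot (dir t) z) ->
  (forall z, K z -> slope z < s -> 1 <= eucl_norm z) ->
  (s - slope x) * (m / 2) `^ (1 - p) <= 4 * Lambda * (b - a).
Proof.
move=> xa yb /andP[a0 ab] b1 sy m0 mH zs1; have [Kx _] := xa; have [Ky _] := yb.
have [xi xiP] : exists xi : R -> P, forall t, supports K (dir t) (xi t).
  by apply: support_selection => //; exists x.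
(* N contains the points of the arc without a unique normal. *)
pose N : set P := \bigcup_(r in [set: rat]) [set xi (ratr r)].
pose B := (top_arc K e e' `&` [set z | slope x < slope z < s]) `\` N.
have mslope : measurable_fun setT slope.
  by apply: measurable_funB; exact: measurable_dot.
have mB : measurable B.
  apply: measurableD; last first.
    by apply: bigcupT_measurable_rat => r; exact: measurable_plane_set1.
  apply: measurableI; first exact: measurable_top_arc.
  rewrite (_ : [set z | _] = setT `&` slope @^-1` `]slope x, s[); first exact: mslope.
  by rewrite setTI; apply/seteqP; split => z /=; rewrite in_itv.
have BP z : B z -> exists t, [/\ a <= t <= b, supports K (dir t) z,
    regular_boundary K z & gauss_map K z = udir e e' t].
  move=> [[tz /= /andP[xz zs]] nN].
  apply: (top_arc_regular bodyK ee' xiP xa yb tz); first by rewrite xz (lt_le_trans zs).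
  by move=> r zr; apply: nN; exists r.
pose w := normal_arc e e' a b.
have wE := normal_arcP ee' a b.
have wS : w `<=` unit_circle by move=> u [].
have mw : measurable w by exact: measurable_normal_arc.
have /andP[_ upper] := curvature_bounds mw wS.
have length_w : (hausdorff1 w <= (2 * (b - a))%:E)%E.
  rewrite /w wE; apply: hausdorff1_lipschitz_image => // s' t' _ _.
  exact: udir_lipschitz.
have length_B : (((s - slope x) / 2)%:E <= hausdorff1 B)%E.
  rewrite mulrBl; apply: (@hausdorff1_ge_projection _ (fun z => slope z / 2) _
    ((fun z => slope z / 2) @` N)).
  - exact: slope_lipschitz.
  - apply: sub_countable (card_image_le _ _) _.
    by apply: bigcup_countable => // r _; exact: countable1.
  - move=> t /=; rewrite in_itv/= => /andP[t1 t2].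
    have [|z tz zt] := @top_arc_ex _ K e e' bodyK ee' (2 * t) x y Kx Ky; first by lra.
    have [zN|zN] := pselect (N z).
      by right; exists z => //; rewrite zt; lra.
    by left; exists z; [split => //; split => //=; rewrite zt; lra|rewrite zt; lra].
have lower : (((m / 2) `^ (1 - p))%:E * hausdorff1 B <= lp_dual_curvature p q K w)%E.
  apply: le_integral_superset => //.
  - move=> z /BP[t [tab _ zr zg]]; split => //=; by rewrite zg /w wE; exists t.
  - exact: powR_ge0.
  - by move=> z _; rewrite mulr_ge0 ?powR_ge0.
  - move=> z Bz; have [t [tab tz _ ->]] := BP _ Bz.
    have {Bz}z1 : 1 <= eucl_norm z.
      by apply: zs1; [case: Bz => -[[]]|case: Bz => -[_ /andP[]]].
    have n0 := norm_dir_gt0 ee' t.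
    have n2 : eucl_norm (dir t) <= 2.
      by apply: norm_dir_le2; case/andP: tab => ta tb; lra.
    have h1 : 1 <= eucl_norm z `^ (q - 2).
      by rewrite -[leLHS](powRr0 (eucl_norm z)) ler_powR// subr_ge0.
    apply: le_trans (ler_peMl (powR_ge0 _ _) h1).
    apply: ge0_ler_powR; rewrite ?subr_ge0 ?(ltW p_lt1) ?nnegrE ?divr_ge0//.
      by rewrite /udir dotC dotZl mulr_ge0 ?invr_ge0 ?(ltW n0)// (le_trans m0)// mH.
    rewrite /udir dotC dotZl [leRHS]mulrC.
    apply: (@le_trans _ _ (dot (dir t) z / 2)); first by rewrite ler_wpM2r// mH.
    by rewrite ler_wpM2l ?lef_pV2 ?posrE// (le_trans m0)// mH.
have := le_trans (le_trans (lee_wpmul2l _ length_B) lower)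
  (le_trans upper (lee_wpmul2l _ length_w)).
by rewrite -!EFinM => /(_ (powR_ge0 _ _) (ltW Lambda_gt0)); rewrite lee_fin; lra.
Qed.

Variable D : R.
Hypotheses (KD : forall z, K z -> eucl_norm z <= D) (De : K (D *: e)).
Hypothesis D_large : 192 * Lambda / p < D.

(** Applies [subgradient_zero] to the support function along [dir t], starting
    at t = 0 from the farthest point D e, which is the only support point in
    the direction e. A slope of absolute value s forces |z| >= s / 2, so that
    |z| >= 1 in the steep range. *)
Lemma exists_nonpositive_direction :
  exists2 t : R, 0 <= t <= 3 / 2 & forall z, K z -> dot (dir t) z <= 0.
Proof.
have L0 := Lambda_gt0; have L1 := Lambda_ge1; have p1 := p_lt1.
have pD : 192 * Lambda < p * D by rewrite [ltRHS]mulrC -ltr_pdivrMr.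
have D0 : 0 < D by rewrite -(pmulr_rgt0 _ p_gt0); lra.
have D192 : 192 < D.
  have : 0 <= (1 - p) * D by rewrite mulr_ge0 ?subr_ge0 ?ltW.
  by lra.
have [e1 e'1 eo] := ee'; have eo' : dot e' e = 0 by rewrite dotC.
have [xi xiP] : exists xi : R -> P, forall t, supports K (dir t) (xi t).
  by apply: support_selection => //; exists 0.
pose h t := dot (dir t) (xi t); pose sg t := slope (xi t).
have slopeD z : K z -> `|slope z| <= 2 * eucl_norm z.
  move=> Kz; apply: (le_trans (ler_normB _ _)).
  have := dot_le_eucl_norm z (iffRL (unit_circleE e) e1).
  have := dot_le_eucl_norm z (iffRL (unit_circleE e') e'1); lra.
suff [t t01 ht] : exists2 t : R, 0 <= t <= 3 / 2 & h t <= 0.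
  by exists t => // z Kz; apply: le_trans ht; have [_] := xiP t; exact.
have [h0 sg0] : h 0 = D /\ sg 0 = - D.
  have [Kx xmax] := xiP 0.
  have := xmax _ De.
  rewrite /h /sg !dot_dir /slope !dotZr e1 eo' !mul0r !addr0 mulr1 => a1.
  have := KD Kx; rewrite eucl_norm_le ?(ltW D0)// (dot_frame ee') => a2.
  have a3 : dot e' (xi 0) = 0.
    by apply/eqP; rewrite -sqrf_eq0; apply/eqP/le_anti; rewrite sqr_ge0 andbT; nra.
  have a4 : dot e (xi 0) = D.
    by apply/le_anti; rewrite a1 andbT; move: a2; rewrite a3; nra.
  by rewrite a3 a4 sub0r.
apply: (@subgradient_zero _ p Lambda D h sg) => //.
- move=> t r; have [_ /(_ (xi r) (xiP r).1)] := xiP t.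
  by rewrite /h /sg !dot_dir; lra.
- move=> t; have [Kx _] := xiP t; apply: le_trans (slopeD _ Kx) _.
  by rewrite ler_wpM2l// KD.
- move=> a b s m a0b b1 sb sD m0 mh.
  apply: (slope_increment (xiP a) (xiP b)) => //.
    by move=> t z tab [_ zt]; apply: le_trans (mh _ tab) (zt _ (xiP t).1).
  by move=> z Kz zs; have := slopeD z Kz; rewrite ler_norml => /andP[]; lra.
Qed.

End arc_estimate.

(** * The uniform bound *)

(** The arc of angle 45 degrees starting at e projects along e onto an interval
    containing `[0, 1 / 2]. *)
Lemma hausdorff1_normal_arc_gt0 (R : realType) (e e' : (R * R)%type) :
  orthonormal_pair e e' -> (0 < hausdorff1 (normal_arc e e' 0 (1 / 2)))%E.
Proof.
move=> ee'; have [e1 e'1 eo] := ee'; have eo' : dot e' e = 0 by rewrite dotC.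
apply: (@lt_le_trans _ _ (1 / 2 - 0)%:E); first by rewrite lte_fin; lra.
apply: (@hausdorff1_ge_projection _ (dot e') _ set0).
- by move=> x y; rewrite -dotBr dot_le_eucl_norm//; apply/unit_circleE.
- exact: countable0.
- move=> b /=; rewrite in_itv/= => /andP[b0 b1]; left.
  pose a := Num.sqrt (1 - b ^+ 2).
  have a2 : a ^+ 2 = 1 - b ^+ 2 by rewrite sqr_sqrtr//; nra.
  have a0 : 0 <= a := sqrtr_ge0 _.
  have ab : b <= a by rewrite -ler_sqr ?nnegrE ?(ltW b0)// a2; nra.
  have eu : dot e (a *: e + b *: e') = a by rewrite dotDr !dotZr e1 eo; ring.
  have e'u : dot e' (a *: e + b *: e') = b by rewrite dotDr !dotZr e'1 eo'; ring.
  exists (a *: e + b *: e') => //; split.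
  + by apply/unit_circleE; rewrite (dot_frame ee') eu e'u -!expr2 a2; ring.
  + by rewrite dotDl eu e'u; lra.
  + by rewrite dotBl dotZl dotDl eu e'u; lra.
  + by rewrite dotBl dotZl dotDl eu e'u; lra.
Qed.

(** If D exceeded the bound, the support function of K would vanish at some
    dir t and, on the other side of e, at some dir s. These directions span a
    cone containing - e, on which it vanishes too; this contradicts
    [support_zero_null]. *)
Lemma body_contained_in_disc (R : realType) (p q Lambda : R)
    (f : (R * R)%type -> R) (K : set (R * R)) :
  0 < p -> p < 1 -> 2 <= q -> 1 <= Lambda -> measurable_fun setT f ->
  {ae arclength, forall u, Lambda^-1 <= f u <= Lambda} ->
  convex_body_o K ->
  (forall omega : set (R * R), measurable omega -> omega `<=` unit_circle ->
    lp_dual_curvature p q K omega = (\int[arclength]_(u in omega) (f u)%:E)%E) ->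
  forall z, K z -> eucl_norm z <= 192 * Lambda / p.
Proof.
move=> p0 p1 q2 L1 mf fb [bodyK K0] curv.
have [cK _ _] := bodyK.
have [|x xK xmax] := @compact_EVT_max (R * R)%type R (@eucl_norm R) K
    (ex_intro _ 0 K0) cK.
  apply: continuous_subspaceT => u; apply: continuous_comp; last exact: sqrt_continuous.
  by apply: cvgD; apply: cvgM; (exact: cvg_fst || exact: cvg_snd).
rewrite inE in xK; set D := eucl_norm x in xmax.
have KD z : K z -> eucl_norm z <= D by move=> Kz; apply: xmax; rewrite inE.
suff DC : D <= 192 * Lambda / p by move=> z /KD /le_trans; apply.
rewrite leNgt; apply/negP => D_large.
have D0 : 0 < D.
  by apply: le_lt_trans D_large; rewrite divr_ge0 ?mulr_ge0 ?(ltW p0)//; lra.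
have [e [De e1]] : exists e, D *: e = x /\ dot e e = 1.
  exists (D^-1 *: x); rewrite scalerA mulfV ?gt_eqF// scale1r; split => //.
  by apply/unit_circleE; exact: unit_circle_normalize.
have KDe : K (D *: e) by rewrite De.
have [e' ee' eNe'] := orthonormal_pair_ex e1.
have [_ e'1 eo] := ee'; have eo' : dot e' e = 0 by rewrite dotC.
have dirs e'' (h : orthonormal_pair e e'') := exists_nonpositive_direction
  p0 p1 q2 L1 mf fb bodyK K0 curv h KD KDe D_large.
have [t /andP[t0 t1]] := dirs _ ee'.
have [s /andP[s0 s1]] := dirs _ eNe'.
move=> Ks Kt.
have {}Kt z : K z -> t * dot e' z <= (t - 1) * dot e z.
  by move=> /Kt; rewrite dot_dir /slope; lra.
have {}Ks z : K z -> - (s * dot e' z) <= (s - 1) * dot e z.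
  by move=> /Ks; rewrite dot_dir /slope dotNl; lra.
have ge1 r : 0 <= (r - 1) * dot e (D *: e) -> 1 <= r.
  by rewrite dotZr e1 mulr1 pmulr_lge0// subr_ge0.
have e'De : dot e' (D *: e) = 0 by rewrite dotZr eo' mulr0.
have t_ge1 : 1 <= t by apply: ge1; have := Kt _ KDe; rewrite e'De mulr0.
have s_ge1 : 1 <= s by apply: ge1; have := Ks _ KDe; rewrite e'De mulr0 oppr0.
(* Adding s times the first inequality to t times the second one cancels e'.
   The remaining coefficient of e vanishes only if s = t = 1, in which case the
   two directions are opposite and K is contained in a line. *)
have half_plane z : K z -> 0 <= dot e z.
  move=> Kz; have [ts|ts] := ltP 2 (t + s).
    have c0 : 0 < s * (t - 1) + t * (s - 1) by nra.
    have : s * (t * dot e' z) <= s * ((t - 1) * dot e z) by rewrite ler_wpM2l// Kt.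
    have : t * - (s * dot e' z) <= t * ((s - 1) * dot e z) by rewrite ler_wpM2l// Ks.
    move=> h1 h2.
    have : 0 <= (s * (t - 1) + t * (s - 1)) * dot e z by lra.
    by rewrite pmulr_rge0.
  have tE : t = 1 by lra.
  have sE : s = 1 by lra.
  have e'0 : e' = 0.
    apply: (convex_body_not_flat bodyK (x := 0)) => y Ky; rewrite dot0r.
    by have := Kt _ Ky; have := Ks _ Ky; rewrite tE sE; lra.
  by move: e'1; rewrite e'0 dot0r; lra.
have Nee' : orthonormal_pair (- e) e'.
  split => //; first by rewrite dotNl dotC dotNl opprK.
  by rewrite dotNl eo oppr0.
pose w := normal_arc (- e) e' 0 (1 / 2).
have mw : measurable w by exact: measurable_normal_arc.
have wS : w `<=` unit_circle by move=> u [].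
have := hausdorff1_normal_arc_gt0 Nee'; rewrite ltNge => /negP; apply.
apply: (support_zero_null p1 L1 mf fb bodyK K0 curv mw wS) => u z + Kz.
rewrite /w normal_arcP// => -[r /=]; rewrite in_itv/= => /andP[r0 r1] <-.
rewrite dotZl pmulr_rle0 ?invr_gt0 ?norm_dir_gt0//.
rewrite dot_dir /slope !dotNl.
have ez := half_plane _ Kz; have tz := Kt _ Kz.
(* (t - 1) / t <= 1 / 3 for t <= 3 / 2, so the cone spanned by - e and dir t
   contains all normals within 45 degrees of - e on the side of e'. *)
have : t * dot e' z <= t * (3^-1 * dot e z).
  apply: (le_trans tz).
  have : 0 <= (t / 3 - (t - 1)) * dot e z by rewrite mulr_ge0//; lra.
  lra.
rewrite ler_pM2l; last by lra.
move=> h; have : r * dot e' z <= r * (3^-1 * dot e z) by rewrite ler_wpM2l.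
have : 0 <= (1 / 2 - r) * dot e z by rewrite mulr_ge0//; lra.
lra.
Qed.

Theorem theorem1p1 (R : realType) (p q Lambda : R)
    (p_gt0 : 0 < p) (p_lt1 : p < 1) (q_ge2 : 2 <= q) (Lambda_ge1 : 1 <= Lambda) :
  exists C : R, 0 < C /\
    forall (f : (R * R)%type -> R) (K : set (R * R)),
      f \in Lfun arclength +oo%E ->
      {ae arclength, forall u, Lambda^-1 <= f u <= Lambda} ->
      convex_body_o K ->
      (forall omega : set (R * R), measurable omega -> omega `<=` unit_circle ->
        lp_dual_curvature p q K omega = (\int[arclength]_(u in omega) (f u)%:E)%E) ->
      ('N[arclength]_+oo [EFin \o support_function K] <= C%:E)%E.
Proof.
pose C := 192 * Lambda / p.
have C0 : 0 < C by rewrite divr_gt0// mulr_gt0// (lt_le_trans _ Lambda_ge1).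
exists C; split => // f K fL fb [bodyK K0] curv.
have mf : measurable_fun setT f by have := sub_Lfun_mfun fL; rewrite inE.
have KC := body_contained_in_disc p_gt0 p_lt1 q_ge2 Lambda_ge1 mf fb
  (conj bodyK K0) curv.
have [cK _ _] := bodyK.
rewrite unlock /=; case: ifP => _; last by rewrite lee_fin ltW.
apply/ess_supP; exists (~` unit_circle); split.
- by apply: measurableC; exact: measurable_unit_circle.
- have -> : arclength (~` unit_circle) =
    hausdorff1 (~` unit_circle `&` unit_circle) by [].
  by rewrite setICl measure0.
- move=> u /=; apply: contra_not => u1; rewrite lee_fin.
  have [x ux] := supports_ex u cK (ex_intro _ 0 K0).
  rewrite (support_functionE ux); apply: le_trans (KC _ ux.1).
  exact: dot_le_eucl_norm.
Qed.
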